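(* Let $K_4$ be the virtual knot $4.43$ of Green's table of virtual knots and let $G(K_4)=G_A(K_4)$ be its group. Then: (1) $G(K_4)$ is isomorphic to a semidirect product $H_4\rtimes\mathbb{Z}$, where $$H_4=\cdots\underset{B_{k-1}}{\ast}A_k\underset{B_k}{\ast}A_{k+1}\underset{B_{k+1}}{\ast}A_{k+2}\underset{B_{k+2}}{\ast}\cdots$$ is the (two-sided infinite) amalgamated free product with $$A_k=\langle x_k,x_{k+1},x_{k+2}\mid [x_{k+1},\ x_{k+2}^{-1}x_{k+1}x_{k+2}^{-1}x_k^{-1}x_{k+1}x_k^{-1}]=1\rangle,$$ and $B_k=\langle x_{k+1},x_{k+2}\rangle$ is a free group of rank 2, $k\in\mathbb{Z}$. (2) $G(K_4)/\gamma_4G(K_4)\cong F_2/\gamma_4F_2$, $\ \gamma_4G(K_4)/\gamma_5G(K_4)\cong\mathbb{Z}^2\times\mathbb{Z}_2$, and $G(K_4)/\gamma_5G(K_4)\not\cong F_2/\gamma_5F_2$, where $F_2$ is the free group of rank 2.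
   Context: Notation: $x^{y}=y^{-1}xy$, $[x,y]=x^{-1}y^{-1}xy$. Lower central series: $\gamma_1(G)=G$, $\gamma_{i+1}(G)=[\gamma_i(G),G]$. $\mathbb{Z}_m$ is the cyclic group of order $m$. In the amalgamated product, $B_k$ is the common subgroup of $A_k$ and $A_{k+1}$ generated in each by the generators named $x_{k+1},x_{k+2}$, identified by name. The group $G_A(K)$ of a virtual knot $K$ is computed from a diagram: the diagram is divided into arcs running from one crossing (real or virtual) to the next, each arc gets a generator, there is one extra generator $y$, each real crossing gives a Wirtinger-type relation, and at each virtual crossing the generators on the two sides of the crossing along a strand are related by conjugation by $y^{\pm1}$. For the diagram of $K_4$ used here this group is $$G(K_4)=\langle x_1,x_2,x_3,x_4,x_5,x_6,y\mid x_1x_5=x_6x_1,\ x_5x_1=x_2x_5,\ x_2x_4=x_5x_2,\ x_6x_2=x_3x_6,\ x_4=x_3^{y},\ x_6=x_1^{y}\rangle,$$ and this presentation may be taken as the definition of $G(K_4)$. (The generators $x_k$, $k\in\mathbb{Z}$, of the groups $A_k$ are separate symbols, unrelated to the diagram generators.) *)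

(* Defs.v *)
From HB Require Import structures.
From mathcomp Require Import all_boot ssralg ssrnum ssrint zmodp.
From mathcomp Require Import boolp classical_sets.
Set Implicit Arguments.
Unset Strict Implicit.
Unset Printing Implicit Defensive.

Local Open Scope group_scope.
Local Open Scope classical_set_scope.
Local Open Scope quotient_scope.

Definition isomorphic (G H : groupType) : Prop :=
  exists f : {multiplicative G -> H}, bijective f.

Definition is_subgroup (G : groupType) (H : set G) : Prop :=
  H 1 /\ forall x y, H x -> H y -> H (x / y).

Definition is_normal (G : groupType) (N : set G) : Prop :=
  is_subgroup N /\ forall x g, N x -> N (x ^ g).

Record subgroup (G : groupType) :=
  Subgroup { subgroup_set :> set G; subgroupP : is_subgroup subgroup_set }.

Record normal_subgroup (G : groupType) :=
  NormalSubgroup { normal_set :> set G; normalP : is_normal normal_set }.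

Coercion normal_to_subgroup (G : groupType) (N : normal_subgroup G) :
  subgroup G := Subgroup (normalP N).1.

Section SubgroupFacts.
Variables (G : groupType) (H : set G) (sgH : is_subgroup H).

Lemma is_subgroup1 : H 1. Proof. exact: sgH.1. Qed.

Lemma is_subgroupV x : H x -> H x^-1.
Proof. by move=> Hx; rewrite -[x^-1]mul1g; apply: sgH.2 => //; exact: sgH.1. Qed.

Lemma is_subgroupM x y : H x -> H y -> H (x * y).
Proof.
by move=> Hx Hy; rewrite -[y]invgK; apply: sgH.2 => //; exact: is_subgroupV.
Qed.
End SubgroupFacts.

Record subgroup_group (G : groupType) (H : subgroup G) : Type :=
  SubgroupElt { subgroup_val :> G; _ : subgroup_val \in subgroup_set H }.

HB.instance Definition _ (G : groupType) (H : subgroup G) :=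
  [isSub for @subgroup_val G H].
HB.instance Definition _ (G : groupType) (H : subgroup G) :=
  [Choice of subgroup_group H by <:].

Fact subgroup_closed (G : groupType) (H : subgroup G) :
  group_closed (fun x : G => x \in subgroup_set H).
Proof.
have [H1 HF] := subgroupP H.
split; first by rewrite unfold_in; apply/mem_set.
move=> x y; rewrite !unfold_in => /set_mem Hx /set_mem Hy.
by apply/mem_set; exact: HF.
Qed.

HB.instance Definition _ (G : groupType) (H : subgroup G) :=
  SubChoice_isSubGroup.Build G _ (subgroup_group H) (subgroup_closed H).

Fact subgroup_valM (G : groupType) (H : subgroup G) :
  {morph @subgroup_val G H : x y / x * y}.
Proof. exact: valM. Qed.
Fact subgroup_val1 (G : groupType) (H : subgroup G) : @subgroup_val G H 1 = 1.
Proof. exact: val1. Qed.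
HB.instance Definition _ (G : groupType) (H : subgroup G) :=
  isMultiplicative.Build (subgroup_group H) G (@subgroup_val G H)
    (@subgroup_valM G H).
HB.instance Definition _ (G : groupType) (H : subgroup G) :=
  Multiplicative_isUMagmaMorphism.Build (subgroup_group H) G
    (@subgroup_val G H) (@subgroup_val1 G H).

Section Quotient.
Variables (G : groupType) (N : normal_subgroup G).

Definition coset_rel : rel G := fun x y => `[< normal_set N (x^-1 * y) >].

Fact coset_rel_refl : reflexive coset_rel.
Proof. by move=> x; apply/asboolP; rewrite mulVg; case: (normalP N) => -[]. Qed.

Fact coset_rel_sym : symmetric coset_rel.
Proof.
have [sN _] := normalP N.
by move=> x y; apply/asboolP/asboolP => /(is_subgroupV sN); rewrite invgM invgK.
Qed.

Fact coset_rel_trans : transitive coset_rel.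
Proof.
have [sN _] := normalP N.
move=> y x z /asboolP Nxy /asboolP Nyz; apply/asboolP.
by rewrite -(mulgK y x^-1) -mulgA; apply: is_subgroupM => //.
Qed.

Canonical coset_equiv :=
  EquivRel coset_rel coset_rel_refl coset_rel_sym coset_rel_trans.

Definition quotient : Type := {eq_quot coset_equiv}.
HB.instance Definition _ := Choice.on quotient.
HB.instance Definition _ := EqQuotient.on quotient.

Definition coset (x : G) : quotient := \pi_quotient x.

Lemma cosetP x y : reflect (coset x = coset y) (coset_rel x y).
Proof. exact: (eqquotP quotient). Qed.

Lemma coset_surj (u : quotient) : exists x, u = coset x.
Proof. by exists (repr u); rewrite /coset reprK. Qed.

Definition quotient_mul (u v : quotient) : quotient := coset (repr u * repr v).
Definition quotient_inv (u : quotient) : quotient := coset (repr u)^-1.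

Lemma repr_coset x : coset_rel (repr (coset x)) x.
Proof. by apply/cosetP; rewrite /coset reprK. Qed.

Lemma quotient_mulE x y : quotient_mul (coset x) (coset y) = coset (x * y).
Proof.
have [sN nN] := normalP N.
apply/cosetP/asboolP; rewrite invgM.
have /asboolP Nx := repr_coset x; have /asboolP Ny := repr_coset y.
set x' := repr _ in Nx *; set y' := repr _ in Ny *.
rewrite -!mulgA (_ : _ * _ = (x'^-1 * x) ^ y' * (y'^-1 * y)).
  by apply: is_subgroupM => //; exact: nN.
by rewrite conjgE !mulgA mulgK.
Qed.

Lemma quotient_invE x : quotient_inv (coset x) = coset x^-1.
Proof.
have [sN nN] := normalP N.
apply/cosetP/asboolP; rewrite invgK.
have /asboolP /(is_subgroupV sN) Nx := repr_coset x.
rewrite invgM invgK in Nx; set x' := repr _ in Nx *.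
rewrite (_ : _ * _ = (x^-1 * x') ^ x^-1); first exact: nN.
by rewrite conjgE invgK !mulgA mulgV mul1g.
Qed.

Fact quotient_mulA : associative quotient_mul.
Proof.
move=> u v w; have [x ->] := coset_surj u; have [y ->] := coset_surj v.
by have [z ->] := coset_surj w; rewrite !quotient_mulE mulgA.
Qed.

Fact quotient_mul1 : left_id (coset 1) quotient_mul.
Proof. by move=> u; have [x ->] := coset_surj u; rewrite quotient_mulE mul1g. Qed.

Fact quotient_1mul : right_id (coset 1) quotient_mul.
Proof. by move=> u; have [x ->] := coset_surj u; rewrite quotient_mulE mulg1. Qed.

Fact quotient_mulV : left_inverse (coset 1) quotient_inv quotient_mul.
Proof.
move=> u; have [x ->] := coset_surj u.
by rewrite quotient_invE quotient_mulE mulVg.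
Qed.

Fact quotient_Vmul : right_inverse (coset 1) quotient_inv quotient_mul.
Proof.
move=> u; have [x ->] := coset_surj u.
by rewrite quotient_invE quotient_mulE mulgV.
Qed.

HB.instance Definition _ := isGroup.Build quotient
  quotient_mulA quotient_mul1 quotient_1mul quotient_mulV quotient_Vmul.

Fact coset_gmulfM : {morph coset : x y / x * y}.
Proof. by move=> x y; rewrite -quotient_mulE. Qed.
HB.instance Definition _ :=
  isMultiplicative.Build G quotient coset coset_gmulfM.
HB.instance Definition _ :=
  Multiplicative_isUMagmaMorphism.Build G quotient coset erefl.
End Quotient.

(* For [N] a normal subgroup of [G] contained in [H], the group [H / N]; in
   general, the group [H / (H `&` N)]. *)
Fact normal_restrict (G : groupType) (H : subgroup G) (N : normal_subgroup G) :
  is_normal [set x : subgroup_group H | normal_set N (val x)].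
Proof.
have [sN nN] := normalP N.
split; first split.
- by rewrite /mkset val1; exact: is_subgroup1.
- by move=> x y; rewrite /mkset gmulfF; exact: sN.2.
- by move=> x g; rewrite /mkset gmulfJ; exact: nN.
Qed.

Definition section_group (G : groupType) (H : subgroup G)
    (N : normal_subgroup G) : groupType :=
  quotient (NormalSubgroup (normal_restrict H N)).

Fact generated_subproof (G : groupType) (S : set G) :
  is_subgroup (smallest (@is_subgroup G) S).
Proof.
split=> [H [sH _]|x y Sx Sy H [sH SH]]; first exact: sH.1.
by apply: sH.2; [exact: Sx | exact: Sy].
Qed.

Definition generated (G : groupType) (S : set G) : subgroup G :=
  Subgroup (generated_subproof S).

Fact normal_closure_subproof (G : groupType) (S : set G) :
  is_normal (smallest (@is_normal G) S).
Proof.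
split; first split.
- by move=> H [[sH _] _]; exact: sH.1.
- by move=> x y Sx Sy H [nH SH]; apply: nH.1.2; [exact: Sx | exact: Sy].
- by move=> x g Sx H [nH SH]; apply: nH.2; exact: Sx.
Qed.

Definition normal_closure (G : groupType) (S : set G) : normal_subgroup G :=
  NormalSubgroup (normal_closure_subproof S).

Definition commutator_set (G : groupType) (H K : set G) : set G :=
  generated [set [~ x, y] | x in H & y in K].

Fixpoint gamma_rec (G : groupType) (n : nat) : set G :=
  if n is n'.+1 then commutator_set (@gamma_rec G n') setT else setT.
Arguments gamma_rec : clear implicits.

Fact gamma_normal (G : groupType) (n : nat) : is_normal (gamma_rec G n).
Proof.
elim: n => [|n [_ nIH]] //=; split; first exact: generated_subproof.
move=> x g Sx.
have sP : is_subgroup [set z | commutator_set (gamma_rec G n) setT (z ^ g)].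
  split=> /= [|y z Sy Sz]; first by rewrite conj1g; exact: (generated_subproof _).1.
  by rewrite conjMg conjVg; exact: (generated_subproof _).2.
apply: (Sx _ (conj sP _)) => _ [y Hy [z _ <-]] /= K [_]; apply.
by rewrite conjRg; exists (y ^ g); [exact: nIH | exists (z ^ g)].
Qed.

(* As in the literature the series starts at [gamma G 1 = G]; the index 0 is
   unused. *)
Definition gamma (G : groupType) (i : nat) : normal_subgroup G :=
  NormalSubgroup (gamma_normal G i.-1).

Section FreeGroup.
Variable X : Type.

(* The letter [(x, true)] stands for [x], and [(x, false)] for its inverse. *)
Definition word : Type := {classic seq (X * bool)}.

Inductive freely_equal : word -> word -> Prop :=
| fe_cancel (u v : seq (X * bool)) x b :
    freely_equal (u ++ (x, b) :: (x, ~~ b) :: v) (u ++ v)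
| fe_refl w : freely_equal w w
| fe_sym w1 w2 : freely_equal w1 w2 -> freely_equal w2 w1
| fe_trans w1 w2 w3 :
    freely_equal w1 w2 -> freely_equal w2 w3 -> freely_equal w1 w3.

Definition free_rel : rel word := fun w1 w2 => `[< freely_equal w1 w2 >].

Fact free_rel_refl : reflexive free_rel.
Proof. by move=> w; apply/asboolP; exact: fe_refl. Qed.

Fact free_rel_sym : symmetric free_rel.
Proof. by move=> u v; apply/asboolP/asboolP; exact: fe_sym. Qed.

Fact free_rel_trans : transitive free_rel.
Proof. by move=> v u w /asboolP ? /asboolP ?; apply/asboolP/fe_trans; eauto. Qed.

Canonical free_equiv :=
  EquivRel free_rel free_rel_refl free_rel_sym free_rel_trans.

Definition free_group : Type := {eq_quot free_equiv}.
HB.instance Definition _ := Choice.on free_group.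
HB.instance Definition _ := EqQuotient.on free_group.

Definition word_class (w : seq (X * bool)) : free_group :=
  \pi_free_group (w : word).

Lemma word_classP (w1 w2 : seq (X * bool)) :
  word_class w1 = word_class w2 <-> freely_equal w1 w2.
Proof.
split=> [/(eqquotP free_group)/asboolP //|w12].
by apply/(eqquotP free_group)/asboolP.
Qed.

Lemma word_class_surj (u : free_group) : exists w, u = word_class w.
Proof. by exists (repr u); rewrite /word_class reprK. Qed.

Lemma freely_equal_repr (w : seq (X * bool)) :
  freely_equal (repr (word_class w)) w.
Proof. by apply/word_classP; rewrite /word_class reprK. Qed.

Definition word_inv (w : seq (X * bool)) : seq (X * bool) :=
  rev [seq (a.1, ~~ a.2) | a <- w].

Lemma word_invK : involutive word_inv.
Proof.
move=> w; rewrite /word_inv map_rev revK -map_comp -[RHS]map_id.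
by apply: eq_map => -[x b] /=; rewrite negbK.
Qed.

Lemma fe_cat (u1 u2 v1 v2 : seq (X * bool)) :
  freely_equal u1 u2 -> freely_equal v1 v2 ->
  freely_equal (u1 ++ v1) (u2 ++ v2).
Proof.
move=> u12 v12; apply: (@fe_trans _ (u2 ++ v1)).
  elim: u12 => [u v x b|w|? ? _|? ? ? _ + _].
  - by rewrite -!catA; exact: fe_cancel.
  - exact: fe_refl.
  - exact: fe_sym.
  - exact: fe_trans.
elim: v12 => [u v x b|w|? ? _|? ? ? _ + _].
- by rewrite !catA; exact: fe_cancel.
- exact: fe_refl.
- exact: fe_sym.
- exact: fe_trans.
Qed.

Lemma fe_inv (u v : seq (X * bool)) :
  freely_equal u v -> freely_equal (word_inv u) (word_inv v).
Proof.
elim=> [{}u {}v x b|w|? ? _|? ? ? _ + _].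
- rewrite /word_inv !map_cat /= !rev_cat !rev_cons -!cats1 -!catA /=.
  rewrite -{2}[b]negbK; exact: fe_cancel.
- exact: fe_refl.
- exact: fe_sym.
- exact: fe_trans.
Qed.

Lemma fe_catV (w : seq (X * bool)) : freely_equal (w ++ word_inv w) [::].
Proof.
elim: w => [|[x b] w IHw]; first exact: fe_refl.
rewrite (_ : _ ++ _ = [:: (x, b)] ++ (w ++ word_inv w) ++ [:: (x, ~~ b)]);
  last by rewrite /word_inv /= rev_cons -cats1 -catA.
apply: (@fe_trans _ ([:: (x, b)] ++ [::] ++ [:: (x, ~~ b)])).
  apply: fe_cat; first exact: fe_refl.
  by apply: fe_cat; [exact: IHw | exact: fe_refl].
exact: (fe_cancel [::] [::]).
Qed.

Definition free_mul (u v : free_group) : free_group :=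
  word_class ((repr u : seq (X * bool)) ++ repr v).
Definition free_inv (u : free_group) : free_group :=
  word_class (word_inv (repr u)).

Lemma free_mulE w1 w2 :
  free_mul (word_class w1) (word_class w2) = word_class (w1 ++ w2).
Proof. by apply/word_classP/fe_cat; exact: freely_equal_repr. Qed.

Lemma free_invE w : free_inv (word_class w) = word_class (word_inv w).
Proof. by apply/word_classP/fe_inv; exact: freely_equal_repr. Qed.

Fact free_mulA : associative free_mul.
Proof.
move=> u v w; have [x ->] := word_class_surj u.
have [y ->] := word_class_surj v; have [z ->] := word_class_surj w.
by rewrite !free_mulE catA.
Qed.

Fact free_1mul : left_id (word_class [::]) free_mul.
Proof. by move=> u; have [x ->] := word_class_surj u; rewrite free_mulE. Qed.

Fact free_mul1 : right_id (word_class [::]) free_mul.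
Proof.
by move=> u; have [x ->] := word_class_surj u; rewrite free_mulE cats0.
Qed.

Fact free_mulV : right_inverse (word_class [::]) free_inv free_mul.
Proof.
move=> u; have [x ->] := word_class_surj u; rewrite free_invE free_mulE.
exact/word_classP/fe_catV.
Qed.

Fact free_Vmul : left_inverse (word_class [::]) free_inv free_mul.
Proof.
move=> u; have [x ->] := word_class_surj u; rewrite free_invE free_mulE.
by apply/word_classP; rewrite -{2}[x]word_invK; exact: fe_catV.
Qed.

HB.instance Definition _ := isGroup.Build free_group
  free_mulA free_1mul free_mul1 free_Vmul free_mulV.

Definition free_gen (x : X) : free_group := word_class [:: (x, true)].
End FreeGroup.

(* The group with generators [X] and relators [R]; a relation [u = v] is given
   by the relator [u / v]. *)
Definition presented (X : Type) (R : set (free_group X)) : groupType :=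
  quotient (normal_closure R).

Definition presented_gen (X : Type) (R : set (free_group X)) (x : X) :
  presented R := coset (normal_closure R) (free_gen x).

Definition F2 : groupType := free_group 'I_2.

Definition free_product_relators (I : Type) (A : I -> groupType) :
    set (free_group {i : I & A i}) :=
  [set r | exists (i : I) (a b : A i),
    r = free_gen (Tagged A a) * free_gen (Tagged A b)
        / free_gen (Tagged A (a * b))].

Definition free_product (I : Type) (A : I -> groupType) : groupType :=
  presented (@free_product_relators I A).

Definition free_product_in (I : Type) (A : I -> groupType) (i : I) (a : A i) :
  free_product A := @presented_gen _ (@free_product_relators I A) (Tagged A a).

(* The product  ... *_{B (k-1)} A k *_{B k} A (k+1) *_{B (k+1)} ...  where [B k]
   is mapped to [A k] by [f k] and to [A (k + 1)] by [g k].  The term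
   "amalgamated product" is justified only when all [f k], [g k] are
   injective. *)
Definition line_amalgam (A B : int -> groupType)
    (f : forall k, {multiplicative B k -> A k})
    (g : forall k, {multiplicative B k -> A (k + 1)%R}) : groupType :=
  quotient (normal_closure
    [set r : free_product A | exists (k : int) (b : B k),
      r = free_product_in (f k b) / free_product_in (g k b)]).

Record automorphism_action (K H : groupType) := AutomorphismAction {
  aact :> K -> H -> H;
  aact1 : forall h, aact 1 h = h;
  aactM : forall k l h, aact (k * l) h = aact k (aact l h);
  aact_morph : forall k, {morph aact k : h h' / h * h'} }.

(* [H ><| K], with product (h, k) (h', k') = (h (phi k h'), k k'). *)
Definition semidirect (H K : groupType) (phi : automorphism_action K H) :
  Type := (H * K)%type.

Section Semidirect.
Variables (H K : groupType) (phi : automorphism_action K H).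
Local Notation semidirect := (semidirect phi).

HB.instance Definition _ := Choice.on semidirect.

Lemma aact_1 k : phi k 1 = 1.
Proof. by apply: (mulgI (phi k 1)); rewrite -aact_morph !mulg1. Qed.

Lemma aactV k h : phi k h^-1 = (phi k h)^-1.
Proof. by apply: (mulgI (phi k h)); rewrite -aact_morph !mulgV aact_1. Qed.

Definition sd_mul (u v : semidirect) : semidirect :=
  (u.1 * phi u.2 v.1, u.2 * v.2).
Definition sd_one : semidirect := (1, 1).
Definition sd_inv (u : semidirect) : semidirect := (phi u.2^-1 u.1^-1, u.2^-1).

Fact sd_mulA : associative sd_mul.
Proof. by move=> u v w; rewrite /sd_mul /= aact_morph aactM !mulgA. Qed.

Fact sd_1mul : left_id sd_one sd_mul.
Proof. by case=> h k; rewrite /sd_mul /= aact1 !mul1g. Qed.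

Fact sd_mul1 : right_id sd_one sd_mul.
Proof. by case=> h k; rewrite /sd_mul /= aact_1 !mulg1. Qed.

Fact sd_Vmul : left_inverse sd_one sd_inv sd_mul.
Proof. by case=> h k; rewrite /sd_mul /= -aact_morph !mulVg aact_1. Qed.

Fact sd_mulV : right_inverse sd_one sd_inv sd_mul.
Proof. by case=> h k; rewrite /sd_mul /= -aactM !mulgV aact1 mulgV. Qed.

HB.instance Definition _ := isGroup.Build semidirect
  sd_mulA sd_1mul sd_mul1 sd_Vmul sd_mulV.
End Semidirect.

(* The generators x_1, ..., x_6 are attached to the arcs of a diagram of the
   virtual knot 4.43 of Green's table, with an extra generator y; the relations
   are those of its crossings, real ones first and virtual ones last. *)
Variant K4_gen : Type := K4_x1 | K4_x2 | K4_x3 | K4_x4 | K4_x5 | K4_x6 | K4_y.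

Definition K4_relators : set (free_group K4_gen) :=
  let x1 := free_gen K4_x1 in let x2 := free_gen K4_x2 in
  let x3 := free_gen K4_x3 in let x4 := free_gen K4_x4 in
  let x5 := free_gen K4_x5 in let x6 := free_gen K4_x6 in
  let y := free_gen K4_y in
  [set (x1 * x5) / (x6 * x1); (x5 * x1) / (x2 * x5);
       (x2 * x4) / (x5 * x2); (x6 * x2) / (x3 * x6);
       x4 / (x3 ^ y); x6 / (x1 ^ y)].

Definition GK4 : groupType := presented K4_relators.

(* The generators x_k, x_{k+1}, x_{k+2} of A_k are named by their subscripts. *)
Definition A_name (k : int) : Type := {i : int | (k <= i <= k + 2)%R}.

Fact A_name_subproof (k : int) (d : nat) :
  (d <= 2)%N -> (k <= k + d%:Z <= k + 2)%R.
Proof.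
move=> d2; rewrite -[X in (X <= _)%R]GRing.addr0 !Num.Theory.lerD2l.
by rewrite lez_nat.
Qed.

Definition A_name_at (k : int) (d : nat) (d2 : (d <= 2)%N) : A_name k :=
  exist _ (k + d%:Z)%R (A_name_subproof k d2).

Definition A_relator (k : int) : free_group (A_name k) :=
  let x0 := free_gen (@A_name_at k 0 isT) in
  let x1 := free_gen (@A_name_at k 1 isT) in
  let x2 := free_gen (@A_name_at k 2 isT) in
  [~ x1, x2^-1 * x1 * x2^-1 * x0^-1 * x1 * x0^-1].

Definition A_ (k : int) : groupType := presented [set A_relator k].

Definition A_gen (k : int) (p : A_name k) : A_ k := presented_gen _ p.

(* B_k is realized inside A_k, by the generators named x_{k+1}, x_{k+2}. *)
Definition B_sub (k : int) : subgroup (A_ k) :=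
  generated [set A_gen p | p in [set p : A_name k | (k < val p)%R]].

Definition B_ (k : int) : groupType := subgroup_group (B_sub k).

Definition B_incl (k : int) : {multiplicative B_ k -> A_ k} :=
  @subgroup_val (A_ k) (B_sub k).

(* [j] maps the elements of B_k named x_{k+1}, x_{k+2} to the generators of
   A_{k+1} with the same names. *)
Definition respects_names (k : int)
    (j : {multiplicative B_ k -> A_ (k + 1)%R}) : Prop :=
  forall (b : B_ k) (p : A_name k) (q : A_name (k + 1)%R),
    B_incl k b = A_gen p -> val p = val q -> j b = A_gen q.

Definition H4 (j : forall k, {multiplicative B_ k -> A_ (k + 1)%R}) :
  groupType := line_amalgam B_incl j.

Definition Zgrp : groupType := Algebra.to_multiplicative int.

Definition Z2xZ_2 : groupType := Algebra.to_multiplicative (int * int * 'Z_2)%type.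

(* Main.v *)
Require Import Defs.
From mathcomp Require Import all_boot ssralg ssrnum ssrint zmodp intdiv.
From mathcomp Require Import boolp classical_sets.
From mathcomp Require Import zify ring.
From HB Require Import structures.

(** Eliminating x_2, ..., x_6 presents the group as <a, y | [b, w] = 1> with
    b = a^y, c = b^y and w = c^-1 b c^-1 a^-1 b a^-1; the conjugates
    x_k = a^(y^k) then generate the kernel of the exponent sum in y.
    Setting x_k x_{k+2} = x_{k+1}^2 turns the commutator defining A_k into
    [x_{k+1}, x_{k+1}^-2], so A_k retracts onto <x_{k+1}, x_{k+2}> and onto
    <x_k, x_{k+1}>, and both are free.

    For the lower central series write u = [a, y], s = [u, a], t = [u, y].
    Modulo gamma_4 one has w = s^2 t^-2 b^-2, so the relator [b, w] lies in
    gamma_4 and equals ([s, a]^-1 [t, a])^2 modulo gamma_5.  The group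
    gamma_4(F_2) / gamma_5(F_2) is free abelian on [s, a], [t, a], [t, y], which
    representations by unitriangular 5 x 5 matrices tell apart; dividing by that
    square gives Z^2 x Z_2, whose torsion separates the quotients by gamma_5. *)

Set Implicit Arguments.
Unset Strict Implicit.
Unset Printing Implicit Defensive.
Import GRing.Theory.

Local Open Scope group_scope.

(** * Homomorphisms out of free, presented and quotient groups *)

(** The amalgam meets the knot group in the group presented on all x_k, k in Z, with one relation
    for each k: identifications that preserve names merge the generators of the factors into one
    sequence, and on that presentation Z acts by shifting indices.

    The quotient gamma_4 / gamma_5 is bounded from both sides. Spanning: bilinearity leaves four
    commutators of weight four, and the Hall-Witt identity makes [s, y] and [t, a] equal.
    Independence: a homomorphism to unitriangular 5 x 5 matrices kills gamma_5 and sends gamma_4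
    into the corner entry, where it is additive. Over Z such a homomorphism from the knot group must
    give [s, a] and [t, a] the same corner entry, since their squares agree modulo gamma_5; the
    factor Z_2 is therefore detected by matrices modulo 2. *)

Section Homomorphisms.
Variables G H : groupType.

Definition hom_of (f : G -> H) (fM : {morph f : x y / x * y}) :
    {multiplicative G -> H} :=
  HB.pack f (isMultiplicative.Build G H f fM).

Variable f : {multiplicative G -> H}.

Lemma homM : {morph f : x y / x * y}.
Proof. exact: gmulfM. Qed.

Lemma hom1 : f 1 = 1.
Proof. by apply: (mulgI (f 1)); rewrite -homM !mulg1. Qed.

Lemma homV : {morph f : x / x^-1}.
Proof. by move=> x; apply/divg1_eq; rewrite invgK -homM mulVg hom1. Qed.

Lemma homJ : {morph f : x y / x ^ y}.
Proof. by move=> x y; rewrite !homM homV. Qed.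

Lemma homR : {morph f : x y / [~ x, y]}.
Proof. by move=> x y; rewrite !homM !homV. Qed.

Lemma hom_inj : (forall x, f x = 1 -> x = 1) -> injective f.
Proof. by move=> fI x y xy; apply/divg1_eq/fI; rewrite homM homV xy divgg. Qed.

End Homomorphisms.

Section HomomorphismSets.
Variables (G H : groupType) (f : {multiplicative G -> H}).

Lemma kernel_normal :
  is_normal [set x | f x = 1]%classic.
Proof.
split; first split=> /= [|x y fx fy]; first exact: hom1.
  by rewrite !homM !homV fx fy divgg.
by move=> x g /= fx; rewrite homJ fx conj1g.
Qed.

Lemma equalizer_subgroup (h : {multiplicative G -> H}) :
  is_subgroup [set x | f x = h x]%classic.
Proof.
by split=> /= [|x y fx fy]; rewrite ?hom1 // !homM !homV fx fy.
Qed.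

Lemma inj_surj_isomorphic :
  (forall x, f x = 1 -> x = 1) -> (forall y, exists x, f x = y) ->
  isomorphic G H.
Proof.
move=> /hom_inj fI fS; exists f.
exists (fun y => sval (cid (fS y))) => [x|y]; last by case: cid.
by apply: fI; case: cid.
Qed.

Lemma cancel_isomorphic (h : {multiplicative H -> G}) :
  cancel f h -> cancel h f -> isomorphic G H.
Proof. by move=> fK hK; exists f, h. Qed.
End HomomorphismSets.

Section Generated.
Variables (G : groupType) (S : set G).

Lemma generated_min (K : set G) :
  is_subgroup K -> (forall x, S x -> K x) ->
  forall x, subgroup_set (generated S) x -> K x.
Proof. by move=> sK SK x; apply; split. Qed.

Lemma generated_sub x : S x -> subgroup_set (generated S) x.
Proof. by move=> Sx K [_]; apply. Qed.

Lemma normal_closure_min (K : set G) :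
  is_normal K -> (forall x, S x -> K x) ->
  forall x, normal_set (normal_closure S) x -> K x.
Proof. by move=> nK SK x; apply; split. Qed.

Lemma normal_closure_sub x : S x -> normal_set (normal_closure S) x.
Proof. by move=> Sx K [_]; apply. Qed.

Lemma subgroup_mem (K : subgroup G) (x : subgroup_group K) :
  subgroup_set K (val x).
Proof. by apply/set_mem; exact: (valP x). Qed.

Definition subgroup_elt (K : subgroup G) (x : G) (Kx : subgroup_set K x) :
  subgroup_group K := SubgroupElt (mem_set Kx).

Lemma generated_hom_ext (H : groupType)
    (f h : {multiplicative subgroup_group (generated S) -> H}) :
  (forall b, S (val b) -> f b = h b) -> f =1 h.
Proof.
move=> fh b.
(* Agreement of [f] and [h] is a property of elements of the subgroup type, while [generated_min]
   works with subsets of [G]; hence the quantified membership proof. *)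
pose K := [set x | exists Sx : subgroup_set (generated S) x,
  f (subgroup_elt Sx) = h (subgroup_elt Sx)]%classic.
have sK : is_subgroup K.
  split=> [|x y [Sx fx] [Sy fy]].
    exists (generated_subproof S).1.
    rewrite (_ : subgroup_elt _ = 1) ?hom1 //.
    by apply: val_inj; rewrite val1.
  exists ((generated_subproof S).2 _ _ Sx Sy).
  rewrite (_ : subgroup_elt _ = subgroup_elt Sx / subgroup_elt Sy).
    by rewrite !homM !homV fx fy.
  by apply: val_inj; rewrite !homM !homV.
have [Sb] : K (val b).
  apply: generated_min sK _ _ (subgroup_mem b) => x Sx.
  by exists (generated_sub Sx); exact: fh.
by rewrite (_ : subgroup_elt Sb = b) //; exact: val_inj.
Qed.
End Generated.

Lemma coset_eq (G : groupType) (N : normal_subgroup G) x y :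
  coset N x = coset N y <-> normal_set N (x^-1 * y).
Proof. by split=> [/cosetP/asboolP|Nxy] //; apply/cosetP/asboolP. Qed.

Lemma coset_eq1 (G : groupType) (N : normal_subgroup G) x :
  coset N x = 1 <-> normal_set N x.
Proof.
rewrite -[1]/(coset N 1); split=> [/esym/coset_eq|Nx].
  by rewrite invg1 mul1g.
by apply/esym/coset_eq; rewrite invg1 mul1g.
Qed.

Lemma coset_relator (G : groupType) (R : set G) r :
  R r -> coset (normal_closure R) r = 1.
Proof. by move=> Rr; apply/coset_eq1; exact: normal_closure_sub. Qed.

Lemma coset_relation (G : groupType) (R : set G) x y :
  R (x / y) -> coset (normal_closure R) x = coset (normal_closure R) y.
Proof.
move=> Rxy; apply: divg1_eq; rewrite -(coset_relator Rxy).
by rewrite homM homV.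
Qed.

Section QuotientLift.
Variables (G : groupType) (N : normal_subgroup G).

Variables (H : groupType) (f : {multiplicative G -> H}).
Hypothesis fN : forall x, normal_set N x -> f x = 1.

Definition quotient_lift_fun (u : quotient N) : H := f (repr u).

Lemma quotient_lift_funE x : quotient_lift_fun (coset N x) = f x.
Proof.
rewrite /quotient_lift_fun; have /asboolP /fN := repr_coset N x.
by rewrite homM homV => /mulg1_eq; rewrite invgK.
Qed.

Fact quotient_liftM : {morph quotient_lift_fun : u v / u * v}.
Proof.
move=> u v; have [x ->] := coset_surj u; have [y ->] := coset_surj v.
by rewrite -homM !quotient_lift_funE homM.
Qed.

Definition quotient_lift := hom_of quotient_liftM.

Lemma quotient_liftE x : quotient_lift (coset N x) = f x.
Proof. exact: quotient_lift_funE. Qed.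
End QuotientLift.

Section FreeLift.
Variables (X : Type) (G : groupType).

Section Lift.
Variable g : X -> G.

Definition letter_eval (a : X * bool) : G := if a.2 then g a.1 else (g a.1)^-1.

Definition word_eval (w : seq (X * bool)) : G :=
  foldr (fun a z => letter_eval a * z) 1 w.

Lemma word_eval_cat u v : word_eval (u ++ v) = word_eval u * word_eval v.
Proof. by elim: u => [|a u IHu] /=; rewrite ?mul1g // IHu mulgA. Qed.

Lemma word_eval_fe (u v : seq (X * bool)) :
  freely_equal u v -> word_eval u = word_eval v.
Proof.
elim=> {u v} [u v x b|//|u v _ ->|u v w _ -> _ ->] //.
rewrite !word_eval_cat /=; congr (_ * _).
by case: b; rewrite /letter_eval /= ?mulVKg ?mulKg.
Qed.

Definition free_lift_fun (u : free_group X) : G := word_eval (repr u).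

Lemma free_lift_funE w : free_lift_fun (word_class w) = word_eval w.
Proof. exact/word_eval_fe/freely_equal_repr. Qed.

Fact free_liftM : {morph free_lift_fun : u v / u * v}.
Proof.
move=> u v; have [x ->] := word_class_surj u; have [y ->] := word_class_surj v.
rewrite -[_ * _]/(free_mul _ _) free_mulE !free_lift_funE; exact: word_eval_cat.
Qed.

Definition free_lift := hom_of free_liftM.

Lemma free_liftE x : free_lift (free_gen x) = g x.
Proof. by rewrite /free_lift /= /free_gen free_lift_funE /= mulg1. Qed.
End Lift.

Lemma free_gen_ind (K : set (free_group X)) :
  is_subgroup K -> (forall x, K (free_gen x)) -> forall u, K u.
Proof.
move=> sK Kgen u; have [w ->] := word_class_surj u.
elim: w => [|[x b] w IHw]; first exact: sK.1.
rewrite (_ : word_class _ = word_class [:: (x, b)] * word_class w).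
  apply: is_subgroupM => //; case: b; first exact: Kgen.
  rewrite (_ : word_class _ = (free_gen x)^-1).
    by apply: is_subgroupV => //; exact: Kgen.
  by rewrite -[RHS]/(free_inv _) free_invE.
by rewrite -[RHS]/(free_mul _ _) free_mulE.
Qed.
End FreeLift.

Section PresentedLift.
Variables (X : Type) (R : set (free_group X)).

Section Lift.
Variables (G : groupType) (g : X -> G).
Hypothesis gR : forall r, R r -> free_lift g r = 1.

Fact presented_lift_subproof r :
  normal_set (normal_closure R) r -> free_lift g r = 1.
Proof. exact: (normal_closure_min (kernel_normal (free_lift g)) gR). Qed.

Definition presented_lift : {multiplicative presented R -> G} :=
  quotient_lift presented_lift_subproof.

Lemma presented_liftE x : presented_lift (presented_gen R x) = g x.
Proof. by rewrite /presented_lift quotient_liftE free_liftE. Qed.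
End Lift.

Lemma presented_gen_ind (K : set (presented R)) :
  is_subgroup K -> (forall x, K (presented_gen R x)) -> forall u, K u.
Proof.
move=> sK Kgen u; have [x ->] := coset_surj u; move: x.
apply: (@free_gen_ind _ [set x | K (coset _ x)]%classic) => //.
by split=> /= [|x y Kx Ky]; [exact: sK.1 | rewrite !homM !homV; exact: sK.2].
Qed.

Lemma presented_hom_ext (G : groupType)
    (f h : {multiplicative presented R -> G}) :
  (forall x, f (presented_gen R x) = h (presented_gen R x)) -> f =1 h.
Proof. exact: (presented_gen_ind (equalizer_subgroup f h)). Qed.

End PresentedLift.

Definition comp_hom (G H K : groupType) (f : {multiplicative H -> K})
    (h : {multiplicative G -> H}) : {multiplicative G -> K} := f \o h.

Lemma comp_homE (G H K : groupType) (f : {multiplicative H -> K})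
  (h : {multiplicative G -> H}) x : comp_hom f h x = f (h x).
Proof. by []. Qed.

Definition id_hom (G : groupType) : {multiplicative G -> G} := @idfun G.

Lemma id_homE (G : groupType) (x : G) : id_hom G x = x.
Proof. by []. Qed.

(** * The amalgamated product and the semidirect decomposition *)

Section K4Word.
Variables (G : groupType) (x0 x1 x2 : G).

Definition K4_word : G := x2^-1 * x1 * x2^-1 * x0^-1 * x1 * x0^-1.

Definition K4_rel : Prop := [~ x1, K4_word] = 1.

Lemma K4_relP : K4_rel <-> commute x1 K4_word.
Proof. by split=> [/eqP/commgP | /commgP/eqP]. Qed.
End K4Word.

Lemma hom_K4_word (G H : groupType) (f : {multiplicative G -> H}) x0 x1 x2 :
  f (K4_word x0 x1 x2) = K4_word (f x0) (f x1) (f x2).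
Proof. by rewrite /K4_word !homM !homV. Qed.

Lemma hom_K4_rel (G H : groupType) (f : {multiplicative G -> H}) x0 x1 x2 :
  K4_rel x0 x1 x2 -> K4_rel (f x0) (f x1) (f x2).
Proof. by rewrite /K4_rel -hom_K4_word -homR => ->; rewrite hom1. Qed.

(* With x_0 x_2 = x_1^2 the word is x_1^-2, so either outer generator can be
   eliminated: this is how A_k retracts onto each of its free subgroups. *)
Lemma K4_rel_left (G : groupType) (p q : G) : K4_rel (p * p * q^-1) p q.
Proof.
apply/K4_relP; rewrite (_ : K4_word _ _ _ = p^-1 * p^-1); last first.
  by rewrite /K4_word !gnorm.
by apply: commuteM; exact/commuteV.
Qed.

Lemma K4_rel_right (G : groupType) (p q : G) : K4_rel p q (p^-1 * q * q).
Proof.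
apply/K4_relP; rewrite (_ : K4_word _ _ _ = q^-1 * q^-1); last first.
  by rewrite /K4_word !gnorm.
by apply: commuteM; exact/commuteV.
Qed.

(** * The groups A_k and their two free subgroups *)

Section AGroups.
Variable k : int.

Lemma A_name_bounds (p : A_name k) :
  val p = k \/ val p = (k + 1)%R \/ val p = (k + 2)%R.
Proof. by have := valP p; lia. Qed.

Lemma A_gen_rel (p0 p1 p2 : A_name k) :
  val p0 = k -> val p1 = (k + 1)%R -> val p2 = (k + 2)%R ->
  K4_rel (A_gen p0) (A_gen p1) (A_gen p2).
Proof.
move=> v0 v1 v2.
have -> : p0 = @A_name_at k 0 isT by apply: val_inj; rewrite v0 /= addr0.
have -> : p1 = @A_name_at k 1 isT by apply: val_inj; rewrite v1.
have -> : p2 = @A_name_at k 2 isT by apply: val_inj; rewrite v2.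
have := @coset_relator _ [set A_relator k]%classic (A_relator k) erefl.
by rewrite /A_relator homR !homM !homV.
Qed.

Section Lift.
Variables (G : groupType) (x : int -> G).
Hypothesis xR : K4_rel (x k) (x (k + 1)%R) (x (k + 2)%R).

Fact A_lift_subproof r :
  [set A_relator k]%classic r ->
  free_lift (fun p : A_name k => x (val p)) r = 1.
Proof.
move=> ->; rewrite /A_relator homR !homM !homV !free_liftE /= addr0; exact: xR.
Qed.

(** The images come from a family indexed by all integers, so the image of a generator depends only
    on its name. Lifts of one family to A_k and A_{k+1} therefore agree on the generators of B_k. *)
Definition A_lift : {multiplicative A_ k -> G} :=
  presented_lift A_lift_subproof.

Lemma A_liftE (p : A_name k) : A_lift (A_gen p) = x (val p).
Proof. exact: presented_liftE. Qed.
End Lift.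

Lemma A_hom_ext (G : groupType) (f h : {multiplicative A_ k -> G}) :
  (forall p, f (A_gen p) = h (A_gen p)) -> f =1 h.
Proof. exact: presented_hom_ext. Qed.
End AGroups.

Definition F2_gen (i : 'I_2) : F2 := free_gen i.
Local Notation gen_p := (F2_gen ord0).
Local Notation gen_q := (F2_gen ord_max).

Definition F2_lift (G : groupType) (a b : G) : {multiplicative F2 -> G} :=
  free_lift (fun i : 'I_2 => if i == ord0 then a else b).

Lemma F2_lift0 (G : groupType) (a b : G) : F2_lift a b gen_p = a.
Proof. by rewrite free_liftE. Qed.

Lemma F2_lift1 (G : groupType) (a b : G) : F2_lift a b gen_q = b.
Proof. by rewrite free_liftE. Qed.

Lemma F2_gen_ind (K : set F2) :
  is_subgroup K -> K gen_p -> K gen_q -> forall u, K u.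
Proof.
move=> sK Kp Kq; apply: free_gen_ind => // i.
case: i => -[|[|//]] i2.
  by rewrite (_ : Ordinal i2 = ord0) //; exact: val_inj.
by rewrite (_ : Ordinal i2 = ord_max) //; exact: val_inj.
Qed.

Lemma F2_hom_ext (G : groupType) (f h : {multiplicative F2 -> G}) :
  f gen_p = h gen_p -> f gen_q = h gen_q -> f =1 h.
Proof. by move=> fp fq; apply: (F2_gen_ind (equalizer_subgroup f h)). Qed.

Section FreeSubgroups.
Variable k : int.

(** Left and right tell on which side of the amalgamated subgroup the factor stands. A left factor
    A_k meets B_k in its last two generators, a right factor A_k meets B_{k-1} in its first two; the
    remaining generator is sent to the solution of x_k x_{k+2} = x_{k+1}^2. *)
Definition A_left_name (i : int) : F2 :=
  if i == k then gen_p * gen_p * gen_q^-1 else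
  if i == (k + 1)%R then gen_p else gen_q.

Definition A_right_name (i : int) : F2 :=
  if i == k then gen_p else if i == (k + 1)%R then gen_q else
  gen_p^-1 * gen_q * gen_q.

Fact int_succ_neq (i : int) :
  ((i + 1)%R == i = false) * ((i + 2)%R == i = false) *
  ((i + 2)%R == (i + 1)%R = false).
Proof. by do !split; lia. Qed.

Fact A_left_rel :
  K4_rel (A_left_name k) (A_left_name (k + 1)%R) (A_left_name (k + 2)%R).
Proof. rewrite /A_left_name !eqxx !int_succ_neq; exact: K4_rel_left. Qed.

Fact A_right_rel :
  K4_rel (A_right_name k) (A_right_name (k + 1)%R) (A_right_name (k + 2)%R).
Proof. rewrite /A_right_name !eqxx !int_succ_neq; exact: K4_rel_right. Qed.

Definition A_retract_left : {multiplicative A_ k -> F2} := A_lift A_left_rel.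
Definition A_retract_right : {multiplicative A_ k -> F2} := A_lift A_right_rel.

Definition A_name1 := @A_name_at k 1 isT.
Definition A_name2 := @A_name_at k 2 isT.
Definition A_name0 := @A_name_at k 0 isT.

Definition F2_in_left : {multiplicative F2 -> A_ k} :=
  F2_lift (A_gen A_name1) (A_gen A_name2).
Definition F2_in_right : {multiplicative F2 -> A_ k} :=
  F2_lift (A_gen A_name0) (A_gen A_name1).

Lemma F2_in_leftK : cancel F2_in_left A_retract_left.
Proof.
apply: (@F2_hom_ext _ (comp_hom A_retract_left F2_in_left) (id_hom F2));
  rewrite comp_homE.
  by rewrite /F2_in_left F2_lift0 A_liftE /= /A_left_name !int_succ_neq eqxx.
by rewrite /F2_in_left F2_lift1 A_liftE /= /A_left_name !int_succ_neq.
Qed.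

Lemma F2_in_rightK : cancel F2_in_right A_retract_right.
Proof.
apply: (@F2_hom_ext _ (comp_hom A_retract_right F2_in_right) (id_hom F2));
  rewrite comp_homE.
  by rewrite /F2_in_right F2_lift0 A_liftE /= /A_right_name addr0 eqxx.
by rewrite /F2_in_right F2_lift1 A_liftE /= /A_right_name !int_succ_neq eqxx.
Qed.

Lemma B_gen_name (p : A_name k) :
  (k < val p)%R -> p = A_name1 \/ p = A_name2.
Proof.
move=> kp; have [v|[v|v]] := A_name_bounds p; first by move: kp; rewrite v; lia.
  by left; exact: val_inj.
by right; exact: val_inj.
Qed.

Lemma F2_in_left_B u : subgroup_set (B_sub k) (F2_in_left u).
Proof.
pose K := [set u | subgroup_set (B_sub k) (F2_in_left u)]%classic.
apply: (@free_gen_ind _ K) => [|i].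
  have [K1 KM] := subgroupP (B_sub k).
  split=> [|v w Kv Kw]; rewrite /K /mkset; first by rewrite hom1.
  by rewrite homM homV; exact: KM.
rewrite /K /mkset /F2_in_left /F2_lift free_liftE.
case: ifP => _; apply: generated_sub.
  by exists A_name1 => //=; lia.
by exists A_name2 => //=; lia.
Qed.

Fact F2_to_B_subproof :
  {morph (fun u => subgroup_elt (F2_in_left_B u)) : u v / u * v}.
Proof. by move=> u v; apply: val_inj; rewrite [RHS]homM; exact: homM. Qed.

Definition F2_to_B : {multiplicative F2 -> B_ k} := hom_of F2_to_B_subproof.

Definition B_to_F2 : {multiplicative B_ k -> F2} :=
  comp_hom A_retract_left (@B_incl k).

Lemma F2_to_BK : cancel F2_to_B B_to_F2.
Proof. exact: F2_in_leftK. Qed.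

Lemma B_to_F2K : cancel B_to_F2 F2_to_B.
Proof.
move=> b; apply: val_inj.
apply: (@generated_hom_ext _ _ _
  (comp_hom F2_in_left B_to_F2) (@B_incl k)) => {}b [p kp pb].
rewrite comp_homE -[B_incl k b]/(val b) -[B_to_F2 b]/(A_retract_left (val b)).
rewrite -pb A_liftE /A_left_name.
have [->|->] := B_gen_name kp; rewrite !int_succ_neq ?eqxx.
  exact: F2_lift0.
exact: F2_lift1.
Qed.

Lemma B_isomorphic_F2 : isomorphic (B_ k) F2.
Proof. exact: cancel_isomorphic B_to_F2K F2_to_BK. Qed.
End FreeSubgroups.

(** An element of B_k is read as a word in two free letters by the left retraction of A_k and
    rewritten in the first two generators of A_{k+1}. Both factors of this composite have left
    inverses, whence injectivity. *)
Definition B_right (k : int) : {multiplicative B_ k -> A_ (k + 1)%R} :=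
  comp_hom (F2_in_right (k + 1)) (B_to_F2 k).

Lemma B_right_inj k : injective (B_right k).
Proof.
exact: inj_comp (can_inj (@F2_in_rightK _)) (can_inj (@B_to_F2K k)).
Qed.

Lemma B_right_names k : respects_names (B_right k).
Proof.
move=> b p q bp pq; rewrite !comp_homE bp A_liftE pq.
have qb : val q = (k + 1)%R \/ val q = (k + 2)%R.
  by have := valP q; have := valP p; rewrite -pq; lia.
rewrite /A_left_name.
case: qb => qE; rewrite qE !int_succ_neq ?eqxx ?F2_lift0 ?F2_lift1;
  by congr A_gen; apply: val_inj; rewrite qE /= ?addr0 // -addrA.
Qed.

(** * The amalgam presented on the sequence of the x_k *)

Definition line_relators : set (free_group int) :=
  [set r | exists k : int, r = [~ free_gen (k + 1)%R,
     K4_word (free_gen k) (free_gen (k + 1)%R) (free_gen (k + 2)%R)]]%classic.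

Definition line_group : groupType := presented line_relators.

Definition line_gen (k : int) : line_group := presented_gen line_relators k.

Lemma line_gen_rel k :
  K4_rel (line_gen k) (line_gen (k + 1)%R) (line_gen (k + 2)%R).
Proof.
rewrite /K4_rel -hom_K4_word -homR; apply: coset_relator.
by exists k.
Qed.

Section LineLift.
Variables (G : groupType) (x : int -> G).
Hypothesis xR : forall k, K4_rel (x k) (x (k + 1)%R) (x (k + 2)%R).

Fact line_lift_subproof r : line_relators r -> free_lift x r = 1.
Proof. by move=> [k ->]; rewrite homR hom_K4_word !free_liftE; exact: xR. Qed.

Definition line_lift : {multiplicative line_group -> G} :=
  presented_lift line_lift_subproof.

Lemma line_liftE k : line_lift (line_gen k) = x k.
Proof. exact: presented_liftE. Qed.
End LineLift.

Lemma line_hom_ext (G : groupType) (f h : {multiplicative line_group -> G}) :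
  (forall k, f (line_gen k) = h (line_gen k)) -> f =1 h.
Proof. exact: presented_hom_ext. Qed.

Section LineAction.
Local Open Scope ring_scope.

Fact line_shift_rel (n k : int) :
  K4_rel (line_gen (k - n)) (line_gen (k + 1 - n)) (line_gen (k + 2 - n)).
Proof. by rewrite ![(k + _ - n)]addrAC; exact: line_gen_rel. Qed.

(** The sign fits the semidirect product: there n acts as conjugation by the inverse of y^n, while
    x_k stands for a^(y^k). *)
Definition line_shift (n : int) : {multiplicative line_group -> line_group} :=
  line_lift (fun k => line_shift_rel n k).

Lemma line_shiftE n k : line_shift n (line_gen k) = line_gen (k - n).
Proof. exact: line_liftE. Qed.

Lemma line_shift0 h : line_shift 0 h = h.
Proof.
apply: (@line_hom_ext _ (line_shift 0) (id_hom _)) h => k.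
by rewrite line_shiftE subr0.
Qed.

Lemma line_shiftD m n h : line_shift (m + n) h = line_shift m (line_shift n h).
Proof.
apply: (@line_hom_ext _ (line_shift (m + n))
  (comp_hom (line_shift m) (line_shift n))) h => k.
by rewrite comp_homE !line_shiftE opprD addrAC addrA.
Qed.
End LineAction.

Section H4Line.
Variable j : forall k, {multiplicative B_ k -> A_ (k + 1)%R}.
Hypothesis jN : forall k, respects_names (j k).

Let amalgam_rel := [set r : free_product A_ | exists (k : int) (b : B_ k),
  r = free_product_in (B_incl k b) / free_product_in (j k b)]%classic.

Fact H4_in_subproof k :
  {morph (fun a : A_ k =>
            coset (normal_closure amalgam_rel) (free_product_in a))
    : a b / a * b}.
Proof.
move=> a b; rewrite -homM; congr coset; apply/esym.
rewrite /free_product_in /presented_gen -[LHS]homM.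
by apply: coset_relation; exists k, a, b.
Qed.

Definition H4_in k : {multiplicative A_ k -> H4 j} :=
  hom_of (@H4_in_subproof k).

Lemma H4_in_amalgam k (b : B_ k) : H4_in k (B_incl k b) = H4_in (k + 1) (j k b).
Proof.
by apply: coset_relation; exists k, b.
Qed.

Lemma H4_hom_ext (G : groupType) (f h : {multiplicative H4 j -> G}) :
  (forall k a, f (H4_in k a) = h (H4_in k a)) -> f =1 h.
Proof.
move=> fh u; have [x ->] := coset_surj u.
apply: (@presented_hom_ext _ _ _
  (comp_hom f (coset (normal_closure amalgam_rel)))
  (comp_hom h (coset (normal_closure amalgam_rel)))) x => -[k a].
exact: fh.
Qed.

Section Lift.
Variables (G : groupType) (f : forall k, {multiplicative A_ k -> G}).
Hypothesis fj : forall k (b : B_ k), f k (B_incl k b) = f (k + 1)%R (j k b).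

Let f_gen (t : {k : int & A_ k}) : G := f (tag t) (tagged t).

Fact free_product_lift_subproof r :
  free_product_relators r -> free_lift f_gen r = 1.
Proof.
move=> [k [a [b ->]]]; rewrite !homM homV !free_liftE /f_gen /= homM.
exact: divgg.
Qed.

Definition free_product_lift : {multiplicative free_product A_ -> G} :=
  presented_lift free_product_lift_subproof.

Lemma free_product_liftE k (a : A_ k) :
  free_product_lift (free_product_in a) = f k a.
Proof. exact: presented_liftE. Qed.

Fact H4_lift_subproof r :
  normal_set (normal_closure amalgam_rel) r -> free_product_lift r = 1.
Proof.
apply: (normal_closure_min (kernel_normal free_product_lift)).
move=> _ [k [b ->]]; rewrite /mkset homM homV !free_product_liftE fj.
exact: divgg.
Qed.

Definition H4_lift : {multiplicative H4 j -> G} :=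
  quotient_lift H4_lift_subproof.

Lemma H4_liftE k a : H4_lift (H4_in k a) = f k a.
Proof. by rewrite /H4_lift quotient_liftE free_product_liftE. Qed.
End Lift.

Definition H4_gen (k : int) : H4 j := H4_in k (A_gen (A_name0 k)).

Lemma H4_in_succ k (p : A_name k) (q : A_name (k + 1)%R) :
  val p = val q -> H4_in k (A_gen p) = H4_in (k + 1) (A_gen q).
Proof.
move=> pq.
have Bp : subgroup_set (B_sub k) (A_gen p).
  apply: generated_sub; exists p => //; rewrite /mkset pq.
  by have := valP q; lia.
rewrite -(@jN k (subgroup_elt Bp) p q erefl pq) -H4_in_amalgam //.
Qed.

(** The reference copy of x_i is the first generator of A_i. The generator k + d of A_k, with d at
    most 2, reaches it after d passages to the next factor, each through [H4_in_succ]. *)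
Lemma H4_in_gen k (p : A_name k) : H4_in k (A_gen p) = H4_gen (val p).
Proof.
have gen0 i (q : A_name i) : val q = i -> H4_in i (A_gen q) = H4_gen i.
  by move=> qi; congr (H4_in i (A_gen _)); apply: val_inj; rewrite qi /= addr0.
have gen1 i (q : A_name i) : val q = (i + 1)%R ->
    H4_in i (A_gen q) = H4_gen (i + 1).
  move=> qi; rewrite (@H4_in_succ i q (A_name0 (i + 1))) //.
  by rewrite qi /= addr0.
have [v|[v|v]] := A_name_bounds p.
- by rewrite gen0 ?v.
- by rewrite gen1 ?v.
rewrite v (@H4_in_succ k p (A_name1 (k + 1))).
  by rewrite gen1 // -addrA.
by rewrite v /= -addrA.
Qed.

Lemma H4_gen_rel k : K4_rel (H4_gen k) (H4_gen (k + 1)%R) (H4_gen (k + 2)%R).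
Proof.
have v0 : val (A_name0 k) = k by rewrite /= addr0.
rewrite -{1}v0 -[(k + 1)%R]/(val (A_name1 k)) -[(k + 2)%R]/(val (A_name2 k)).
by rewrite -!H4_in_gen; apply: hom_K4_rel; exact: A_gen_rel.
Qed.

Definition line_to_H4 : {multiplicative line_group -> H4 j} :=
  line_lift H4_gen_rel.

Definition A_to_line k : {multiplicative A_ k -> line_group} :=
  A_lift (line_gen_rel k).

Fact A_to_line_amalgam k (b : B_ k) :
  A_to_line k (B_incl k b) = A_to_line (k + 1) (j k b).
Proof.
apply: (@generated_hom_ext _ _ _ (comp_hom (A_to_line k) (@B_incl k))
  (comp_hom (A_to_line (k + 1)) (j k))) => {}b [p kp pb].
have kq : ((k + 1 <= val p <= k + 1 + 2)%R).
  by have := valP p; move: kp; rewrite /mkset; lia.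
have bp : B_incl k b = A_gen p by rewrite pb.
rewrite !comp_homE bp (@jN k b p (exist _ (val p) kq) bp) //.
by rewrite !A_liftE.
Qed.

Definition H4_to_line : {multiplicative H4 j -> line_group} :=
  H4_lift A_to_line_amalgam.

Lemma H4_to_lineE k : H4_to_line (H4_gen k) = line_gen k.
Proof. by rewrite /H4_to_line /H4_gen H4_liftE A_liftE /= addr0. Qed.

Lemma line_to_H4K : cancel line_to_H4 H4_to_line.
Proof.
apply: (@line_hom_ext _ (comp_hom H4_to_line line_to_H4) (id_hom _)) => k.
by rewrite comp_homE /line_to_H4 line_liftE H4_to_lineE.
Qed.

Lemma H4_to_lineK : cancel H4_to_line line_to_H4.
Proof.
apply: (@H4_hom_ext _ (comp_hom line_to_H4 H4_to_line) (id_hom _)) => k.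
apply: (@A_hom_ext _ _ (comp_hom (comp_hom line_to_H4 H4_to_line) (H4_in k))
  (comp_hom (id_hom _) (H4_in k))) => p.
rewrite !comp_homE id_homE H4_in_gen H4_to_lineE.
exact: line_liftE.
Qed.

Definition H4_shift (n : Zgrp) (h : H4 j) : H4 j :=
  line_to_H4 (line_shift n (H4_to_line h)).

Fact H4_shift1 h : H4_shift 1 h = h.
Proof. by rewrite /H4_shift line_shift0 H4_to_lineK. Qed.

Fact H4_shiftM m n h : H4_shift (m * n) h = H4_shift m (H4_shift n h).
Proof. by rewrite /H4_shift line_to_H4K -line_shiftD. Qed.

Fact H4_shift_morph n : {morph H4_shift n : h h' / h * h'}.
Proof. by move=> h h'; rewrite /H4_shift !homM. Qed.

Definition H4_action : automorphism_action Zgrp (H4 j) :=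
  AutomorphismAction H4_shift1 H4_shiftM H4_shift_morph.

Lemma H4_shift_gen n k : H4_shift n (H4_gen k) = H4_gen (k - n)%R.
Proof.
by rewrite /H4_shift H4_to_lineE line_shiftE /line_to_H4 line_liftE.
Qed.
End H4Line.

(** * The knot group on two generators *)

Section K4Arcs.
Variables (G : groupType) (a y : G).
Local Notation b := (a ^ y).
Local Notation c := ((a ^ y) ^ y).

Definition K4_arc2 : G := a^-1 * b * a * b^-1 * a.

(** These are the solutions of five of the relations: x_6 from the virtual crossing x_6 = x_1^y,
    then x_5, x_2, x_4, x_3 from the four real crossings. *)
Definition K4_arc (t : K4_gen) : G :=
  match t with
  | K4_x1 => a
  | K4_x2 => K4_arc2
  | K4_x3 => b * K4_arc2 * b^-1
  | K4_x4 => K4_arc2^-1 * (a^-1 * b * a) * K4_arc2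
  | K4_x5 => a^-1 * b * a
  | K4_x6 => b
  | K4_y => y
  end.

(** Both sides of the remaining relation are conjugates of b: with z = a^-1 b a^-1 and v = c b^-1 c,
    x_4 is z b z^-1 and x_3^y is v b v^-1. They agree exactly when b commutes with v^-1 z, which is
    the word w. *)
Lemma K4_arc_rel : K4_rel a b c <-> K4_arc K4_x4 = K4_arc K4_x3 ^ y.
Proof.
have conj3 d : (d * (a^-1 * d * a * d^-1 * a) * d^-1) ^ y =
    d ^ y * ((a ^ y)^-1 * d ^ y * a ^ y * (d ^ y)^-1 * a ^ y) * (d ^ y)^-1.
  by rewrite !(conjMg, conjVg).
rewrite /K4_arc /K4_arc2 conj3; move: (a ^ y) ((a ^ y) ^ y) => b c.
pose v := c * b^-1 * c; pose z := a^-1 * b * a^-1.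
rewrite (_ : _^-1 * _ * _ = z * b * z^-1); last by rewrite /z !gnorm.
rewrite (_ : c * _ * c^-1 = v * b * v^-1); last by rewrite /v !gnorm.
rewrite K4_relP (_ : K4_word a b c = v^-1 * z); last first.
  by rewrite /K4_word /v /z !gnorm.
clearbody v z; split=> [bvz|zv].
  apply/(mulIg z)/(mulgI v^-1); rewrite mulgVK.
  by rewrite mulgA -bvz !gnorm.
by apply: (mulgI v); rewrite !mulgA mulgV mul1g -zv mulgVK.
Qed.

Hypothesis abc : K4_rel a b c.

Fact GK4_lift_subproof r : K4_relators r -> free_lift K4_arc r = 1.
Proof.
have x34 : K4_arc K4_x4 = K4_arc K4_x3 ^ K4_arc K4_y by exact/K4_arc_rel.
move=> [[[[[|]|]|]|]|] ->;
  rewrite !(homJ, homM, homV) !free_liftE ?(=^~ x34) ?divgg //=;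
  by rewrite /K4_arc2; move: (a ^ y) => b; rewrite !gnorm.
Qed.

Definition GK4_lift : {multiplicative GK4 -> G} :=
  presented_lift GK4_lift_subproof.
End K4Arcs.

Definition GK4_gen (t : K4_gen) : GK4 := presented_gen K4_relators t.
Definition GK4_a : GK4 := GK4_gen K4_x1.
Definition GK4_y : GK4 := GK4_gen K4_y.

Lemma GK4_lift_a (G : groupType) (a y : G)
    (aR : K4_rel a (a ^ y) ((a ^ y) ^ y)) :
  GK4_lift aR GK4_a = a.
Proof. exact: presented_liftE. Qed.

Lemma GK4_lift_y (G : groupType) (a y : G)
    (aR : K4_rel a (a ^ y) ((a ^ y) ^ y)) :
  GK4_lift aR GK4_y = y.
Proof. exact: presented_liftE. Qed.

Lemma GK4_arcE t : GK4_gen t = K4_arc GK4_a GK4_y t.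
Proof.
have rel u v : K4_relators (u / v) ->
    coset (normal_closure K4_relators) u = coset (normal_closure K4_relators) v.
  exact: coset_relation.
pose X := GK4_gen.
have E1 : X K4_x1 * X K4_x5 = X K4_x6 * X K4_x1.
  have := rel _ _
    (or_introl (or_introl (or_introl (or_introl (or_introl erefl))))).
  by rewrite !homM.
have E2 : X K4_x5 * X K4_x1 = X K4_x2 * X K4_x5.
  have := rel _ _
    (or_introl (or_introl (or_introl (or_introl (or_intror erefl))))).
  by rewrite !homM.
have E3 : X K4_x2 * X K4_x4 = X K4_x5 * X K4_x2.
  have := rel _ _
    (or_introl (or_introl (or_introl (or_intror erefl)))).
  by rewrite !homM.
have E4 : X K4_x6 * X K4_x2 = X K4_x3 * X K4_x6.
  have := rel _ _
    (or_introl (or_introl (or_intror erefl))).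
  by rewrite !homM.
have E6 : X K4_x6 = GK4_a ^ GK4_y.
  by have := rel _ _ (or_intror erefl); rewrite homJ.
have e5 : X K4_x5 = K4_arc GK4_a GK4_y K4_x5.
  apply: (mulgI (X K4_x1)); rewrite E1 E6 /= -/(X K4_x1).
  by move: (GK4_a ^ _) => b; rewrite !gnorm.
have e2 : X K4_x2 = K4_arc GK4_a GK4_y K4_x2.
  apply: (mulIg (X K4_x5)); rewrite -E2 e5 /= /K4_arc2.
  by move: (GK4_a ^ _) => b; rewrite !gnorm.
case: t => //.
- apply: (mulIg (X K4_x6)); rewrite -[LHS]E4 e2 E6 /=.
  by move: (GK4_a ^ _) => b; rewrite !gnorm.
- apply: (mulgI (X K4_x2)); rewrite [LHS]E3 e2 e5 /=.
  by move: (GK4_a ^ _) => b; rewrite !gnorm.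
Qed.

(** This is what the relation x_4 = x_3^y, the only one not spent on eliminating generators,
    becomes. *)
Lemma GK4_rel : K4_rel GK4_a (GK4_a ^ GK4_y) ((GK4_a ^ GK4_y) ^ GK4_y).
Proof.
apply/K4_arc_rel; rewrite -!GK4_arcE.
have /coset_relation : K4_relators
  (free_gen K4_x4 / free_gen K4_x3 ^ free_gen K4_y) by left; right.
by rewrite homJ.
Qed.

Lemma GK4_gen_ind (K : set GK4) :
  is_subgroup K -> K GK4_a -> K GK4_y -> forall u, K u.
Proof.
move=> sK Ka Ky; apply: presented_gen_ind => // t.
rewrite -[presented_gen _ _]/(GK4_gen t) GK4_arcE.
have KM := is_subgroupM sK; have KV := is_subgroupV sK.
have Kb : K (GK4_a ^ GK4_y) by apply: (KM _ _); [exact: KV | exact: KM].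
have K2 : K (K4_arc2 GK4_a GK4_y).
  by do ![by [] | apply: (KM _ _) | apply: (KV _)].
by case: t => //=; do ![by [] | apply: (KM _ _) | apply: (KV _)].
Qed.

Lemma GK4_hom_ext (G : groupType) (f h : {multiplicative GK4 -> G}) :
  f GK4_a = h GK4_a -> f GK4_y = h GK4_y -> f =1 h.
Proof. by move=> fa fy; apply: (GK4_gen_ind (equalizer_subgroup f h)). Qed.

Section IntPower.
Variables (G : groupType) (x : G).

Definition int_pow (n : int) : G :=
  match n with Posz m => x ^+ m | Negz m => x ^- m.+1 end.

Lemma int_powS n : int_pow (n + 1) = int_pow n * x.
Proof.
case: n => [n|[|n]]; first by rewrite -PoszD addn1 /= expgSr.
  by rewrite /= expg1 mulVg.
rewrite (_ : (Negz n.+1 + 1)%R = Negz n) /=; last by lia.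
by rewrite [x ^+ n.+2]expgS invgM mulgVK.
Qed.

Lemma int_powB1 n : int_pow (n - 1) = int_pow n * x^-1.
Proof. by rewrite -{2}[n](subrK 1%R) int_powS mulgK. Qed.

Lemma int_powD : {morph (int_pow : Zgrp -> G) : m n / m * n}.
Proof.
move=> m n; rewrite -[(m * n)%g]/(m + n)%R.
elim: n => [|n IHn|n IHn]; first by rewrite addr0 mulg1.
  by rewrite -addn1 PoszD addrA !int_powS IHn mulgA.
by rewrite -addn1 PoszD opprD addrA !int_powB1 IHn mulgA.
Qed.

Definition int_power : {multiplicative Zgrp -> G} := hom_of int_powD.
End IntPower.

Lemma hom_int_pow (G H : groupType) (f : {multiplicative G -> H}) x n :
  f (int_pow x n) = int_pow (f x) n.
Proof.
have fX m : f (x ^+ m) = f x ^+ m.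
  by elim: m => [|m IHm]; rewrite ?hom1 // !expgS homM IHm.
by case: n => m /=; rewrite ?homV fX.
Qed.

Section SemidirectEmbeddings.
Variables (K H : groupType) (phi : automorphism_action K H).

Fact sd_inlM : {morph (fun h => (h, 1) : semidirect phi) : h h' / h * h'}.
Proof. by move=> h h'; congr (_, _); rewrite /= ?aact1 ?mulg1. Qed.

Fact sd_inrM : {morph (fun k => (1, k) : semidirect phi) : k k' / k * k'}.
Proof. by move=> k k'; congr (_, _); rewrite /= aact_1 mulg1. Qed.

Definition sd_inl : {multiplicative H -> semidirect phi} := hom_of sd_inlM.
Definition sd_inr : {multiplicative K -> semidirect phi} := hom_of sd_inrM.

Lemma sd_decomp (u : semidirect phi) : u = sd_inl u.1 * sd_inr u.2.
Proof. by case: u => h k; congr (_, _); rewrite /= ?aact1 ?mulg1 ?mul1g. Qed.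

Lemma sd_conj h k : sd_inl h ^ sd_inr k = sd_inl (phi k^-1 h).
Proof.
congr (_, _) => /=; last by rewrite mul1g mulVg.
by rewrite invg1 !aact_1 mulg1 mul1g.
Qed.
End SemidirectEmbeddings.

Lemma int_pow_Zgrp (n : Zgrp) : int_pow (1%R : Zgrp) n = n.
Proof.
have X m : (1%R : Zgrp) ^+ m = Posz m.
  by elim: m => // m IHm; rewrite expgS IHm -[m.+1]add1n PoszD.
by case: n => m /=; rewrite X // NegzE.
Qed.

(** * The isomorphism with the semidirect product *)

Section K4Semidirect.
Variable j : forall k, {multiplicative B_ k -> A_ (k + 1)%R}.
Hypothesis jN : forall k, respects_names (j k).
Let phi := H4_action jN.
Let sd_a : semidirect phi := sd_inl phi (H4_gen j 0).
Let sd_y : semidirect phi := sd_inr phi (1%R : Zgrp).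

Lemma H4_gen_conj (k n : int) :
  sd_inl phi (H4_gen j k) ^ sd_inr phi n = sd_inl phi (H4_gen j (k + n)).
Proof.
rewrite sd_conj -[phi _ _]/(H4_shift jN (- n)%R _).
by rewrite H4_shift_gen opprK.
Qed.

Fact sd_rel : K4_rel sd_a (sd_a ^ sd_y) ((sd_a ^ sd_y) ^ sd_y).
Proof.
rewrite !H4_gen_conj; apply: hom_K4_rel; exact: (H4_gen_rel jN 0).
Qed.

Definition GK4_to_sd : {multiplicative GK4 -> semidirect phi} :=
  GK4_lift sd_rel.

(** Conjugation by y^k is an endomorphism carrying the single relation [GK4_rel] to the relation of
    index k. *)
Fact GK4_conj_rel (k : int) :
  let x i := GK4_a ^ int_pow GK4_y i in
  K4_rel (x k) (x (k + 1)%R) (x (k + 2)%R).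
Proof.
pose f := hom_of (fun u v => conjMg u v (int_pow GK4_y k)).
have x_add i : GK4_a ^ int_pow GK4_y (k + i) = f (GK4_a ^ int_pow GK4_y i).
  by rewrite addrC [int_pow _ (i + k)]int_powD conjgM.
rewrite /= -{1}[k]addr0 !x_add; apply: hom_K4_rel.
rewrite conjg1 /= !expgS expg0 mulg1 conjgM.
exact: GK4_rel.
Qed.

Definition line_to_GK4 : {multiplicative line_group -> GK4} :=
  line_lift GK4_conj_rel.

(** Equivariance: the shift becomes conjugation inside the knot group. This is what makes
    [sd_to_GK4_fun] multiplicative. *)
Lemma line_to_GK4_shift n h :
  line_to_GK4 (line_shift n h) = line_to_GK4 h ^ int_pow GK4_y (- n).
Proof.
pose f := hom_of (fun u v => conjMg u v (int_pow GK4_y (- n)%R)).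
apply: (@line_hom_ext _ (comp_hom line_to_GK4 (line_shift n))
  (comp_hom f line_to_GK4)) => k.
rewrite !comp_homE line_shiftE /line_to_GK4 !line_liftE.
by rewrite [int_pow _ (k - n)]int_powD conjgM.
Qed.

Definition sd_to_GK4_fun (u : semidirect phi) : GK4 :=
  line_to_GK4 (H4_to_line jN u.1) * int_pow GK4_y u.2.

Fact sd_to_GK4_subproof : {morph sd_to_GK4_fun : u v / u * v}.
Proof.
case=> h m [k n].
transitivity (line_to_GK4 (H4_to_line jN (h * H4_shift jN m k)) *
  int_pow GK4_y (m + n)); first by [].
rewrite homM [int_pow _ (m + n)]int_powD.
rewrite /H4_shift line_to_H4K homM line_to_GK4_shift.
have -> : int_pow GK4_y (- m) = (int_pow GK4_y m)^-1.
  exact: (homV (int_power GK4_y) m).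
by rewrite conjgE invgK /sd_to_GK4_fun !mulgA mulgVK.
Qed.

Definition sd_to_GK4 : {multiplicative semidirect phi -> GK4} :=
  hom_of sd_to_GK4_subproof.

Lemma GK4_to_sdK : cancel GK4_to_sd sd_to_GK4.
Proof.
apply: (@GK4_hom_ext _ (comp_hom sd_to_GK4 GK4_to_sd) (id_hom _));
  rewrite comp_homE id_homE.
  rewrite [GK4_to_sd _]GK4_lift_a
    -[LHS]/(line_to_GK4 (H4_to_line jN (H4_gen j 0)) * 1) H4_to_lineE mulg1
    /line_to_GK4 line_liftE.
  exact: conjg1.
by rewrite [GK4_to_sd _]GK4_lift_y
  -[LHS]/(line_to_GK4 (H4_to_line jN 1) * GK4_y) !hom1 mul1g.
Qed.

Lemma sd_to_GK4K : cancel sd_to_GK4 GK4_to_sd.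
Proof.
have yE n : GK4_to_sd (int_pow GK4_y n) = sd_inr phi n.
  rewrite hom_int_pow [GK4_to_sd _]GK4_lift_y -(hom_int_pow (sd_inr phi)).
  by rewrite int_pow_Zgrp.
have hE h : GK4_to_sd (line_to_GK4 h) = sd_inl phi (line_to_H4 jN h).
  apply: (@line_hom_ext _ (comp_hom GK4_to_sd line_to_GK4)
    (comp_hom (sd_inl phi) (line_to_H4 jN))) => k.
  rewrite !comp_homE /line_to_GK4 /line_to_H4 !line_liftE homJ yE.
  by rewrite [GK4_to_sd _]GK4_lift_a H4_gen_conj add0r.
by move=> u; rewrite [RHS]sd_decomp -(H4_to_lineK jN u.1) -hE -yE -[RHS]homM.
Qed.

Lemma GK4_semidirect : isomorphic GK4 (semidirect phi).
Proof. exact: cancel_isomorphic GK4_to_sdK sd_to_GK4K. Qed.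
End K4Semidirect.

(** * Lower central series *)

Section LowerCentralSeries.
Variable G : groupType.
Implicit Types (x y z g : G) (n : nat).

(** Indices are those of [gamma_rec], which start at 0: [gamma_rec G n] is gamma_{n+1}(G), that is,
    [gamma G n.+1]. *)
Lemma gamma_subgroup n : is_subgroup (gamma_rec G n).
Proof. exact: (gamma_normal G n).1. Qed.

Lemma gamma1 n : gamma_rec G n 1.
Proof. exact: (gamma_subgroup n).1. Qed.

Lemma gammaM n x y :
  gamma_rec G n x -> gamma_rec G n y -> gamma_rec G n (x * y).
Proof. exact: is_subgroupM (gamma_subgroup n) _ _. Qed.

Lemma gammaV n x : gamma_rec G n x -> gamma_rec G n x^-1.
Proof. exact: is_subgroupV (gamma_subgroup n) _. Qed.

Lemma gammaJ n x g : gamma_rec G n x -> gamma_rec G n (x ^ g).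
Proof. exact: (gamma_normal G n).2. Qed.

Lemma gammaR n x y : gamma_rec G n x -> gamma_rec G n.+1 [~ x, y].
Proof. by move=> Gx; apply: generated_sub; exists x => //; exists y. Qed.

Lemma gammaS_min n (K : set G) : is_subgroup K ->
  (forall x z, gamma_rec G n x -> K [~ x, z]) ->
  forall g, gamma_rec G n.+1 g -> K g.
Proof.
move=> sK KR; apply: generated_min => // _ [x Gx [z _ <-]].
exact: KR.
Qed.

Lemma gammaS_sub n g : gamma_rec G n.+1 g -> gamma_rec G n g.
Proof.
apply: gammaS_min => [|x z Gx]; first exact: gamma_subgroup.
by apply: gammaM; [exact: gammaV | exact: gammaJ].
Qed.

(** Stated for quotients because [is_subgroup] asks for closure under division. *)
Lemma commg_divl x y z : [~ x / y, z] = ([~ x, z] / [~ y, z]) ^ y^-1.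
Proof. by rewrite /commg /conjg !gnorm. Qed.

Lemma commg_divr x y z : [~ x, y / z] = ([~ x, z]^-1 * [~ x, y]) ^ z^-1.
Proof. by rewrite /commg /conjg !gnorm. Qed.

Lemma conjg_mulR x g : x ^ g = x * [~ x, g].
Proof. by rewrite /commg mulVKg. Qed.

Definition generated_by2 (a y : G) : Prop :=
  forall K : set G, is_subgroup K -> K a -> K y -> forall g, K g.

(* If S spans gamma_n modulo gamma_{n+1}, bilinearity of the commutator modulo
   gamma_{n+2} makes the commutators of S with the two generators span
   gamma_{n+1} modulo gamma_{n+2}. *)
Lemma gamma_step (a y : G) n (S K : set G) : generated_by2 a y ->
  (forall L : set G, is_subgroup L -> (forall x, S x -> L x) ->
     (forall x, gamma_rec G n.+1 x -> L x) ->
     forall x, gamma_rec G n x -> L x) ->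
  is_subgroup K ->
  (forall x, S x -> [/\ gamma_rec G n x, K [~ x, a] & K [~ x, y]]) ->
  (forall x, gamma_rec G n.+2 x -> K x) ->
  forall x, gamma_rec G n.+1 x -> K x.
Proof.
move=> ay Sgen sK SK GK.
(* [K] is only a subgroup, but inside [gamma_rec G n.+1] it is stable under conjugation: x^g differs
   from x by [x, g], which lies in [gamma_rec G n.+2]. *)
have KJ x g : gamma_rec G n.+1 x -> K x -> K (x ^ g).
  move=> Gx Kx; rewrite conjg_mulR; apply: is_subgroupM => //.
  by apply: GK; exact: gammaR.
have KM := is_subgroupM sK; have KV := is_subgroupV sK.
have left z : (forall x, S x -> K [~ x, z]) ->
    forall x, gamma_rec G n x -> K [~ x, z].
  move=> Sz x Gx.
  (* Membership in [gamma_rec G n] is carried through the induction because [KJ] applies only to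
     commutators known to lie in [gamma_rec G n.+1]. *)
  suff [] : gamma_rec G n x /\ K [~ x, z] by [].
  apply: (Sgen [set x | gamma_rec G n x /\ K [~ x, z]]%classic) Gx.
  - split=> [|v w [Gv Kv] [Gw Kw]].
      by split; [exact: gamma1 | rewrite comm1g; exact: sK.1].
    split; first exact: (gamma_subgroup n).2.
    rewrite commg_divl; apply: KJ; last exact: sK.2.
    by apply: gammaM; [|apply: gammaV]; exact: gammaR.
  - by move=> v Sv; split; [case: (SK v Sv) | exact: Sz].
  - move=> v Gv; split; first exact: gammaS_sub.
    by apply: GK; exact: gammaR.
apply: gammaS_min => // x z Gx.
apply: (ay [set z | K [~ x, z]]%classic).
- split=> [|v w Kv Kw]; rewrite /mkset; first by rewrite commg1; exact: sK.1.
  rewrite commg_divr; apply: KJ; last by apply: (KM _ _ _ Kv); exact: KV.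
  by apply: gammaM; [apply: gammaV|]; exact: gammaR.
- by apply: left => // v /SK[].
- by apply: left => // v /SK[].
Qed.
End LowerCentralSeries.

Section LowerCentralMorphisms.
Variables (G H : groupType) (f : {multiplicative G -> H}).

Lemma preimage_subgroup (K : set H) :
  is_subgroup K -> is_subgroup [set x | K (f x)]%classic.
Proof.
move=> sK; split=> [|x y Kx Ky]; rewrite /mkset.
  by rewrite hom1; exact: sK.1.
by rewrite homM homV; exact: sK.2.
Qed.

Lemma image_subgroup (K : set G) :
  is_subgroup K -> is_subgroup [set f x | x in K]%classic.
Proof.
move=> sK; split=> [|_ _ [x Kx <-] [y Ky <-]].
  by exists 1; [exact: sK.1 | exact: hom1].
by exists (x / y); [exact: sK.2 | rewrite homM homV].
Qed.

Lemma gamma_hom n x : gamma_rec G n x -> gamma_rec H n (f x).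
Proof.
elim: n x => [//|n IHn].
apply: (gammaS_min (preimage_subgroup (gamma_subgroup H n.+1))) => x z Gx.
by rewrite /mkset homR; apply: gammaR; exact: IHn.
Qed.

Lemma gamma_surj n : (forall y, exists x, f x = y) ->
  forall y, gamma_rec H n y -> exists2 x, gamma_rec G n x & f x = y.
Proof.
move=> fS; elim: n => [|n IHn] y; first by have [x fx] := fS y; exists x.
move: y; apply: (gammaS_min (image_subgroup (gamma_subgroup G n.+1))) => y z.
move=> /IHn[x Gx <-]; have [t <-] := fS z.
by exists [~ x, t]; [exact: gammaR | rewrite homR].
Qed.
End LowerCentralMorphisms.

Lemma gamma_quotient (G : groupType) n (u : quotient (gamma G n.+1)) :
  gamma_rec (quotient (gamma G n.+1)) n u -> u = 1.
Proof.
have cS v : exists x, coset (gamma G n.+1) x = v.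
  by have [x ->] := coset_surj v; exists x.
by move=> /(@gamma_surj _ _ (coset _) _ cS)[x Gx <-]; exact/coset_eq1.
Qed.

Section NilpotentClass.
Variables (G : groupType) (n : nat).
Hypothesis gammaG : forall x, gamma_rec G n.+1 x -> x = 1.

Lemma gamma_last_commute x z : gamma_rec G n x -> commute x z.
Proof. by move=> Gx; apply/commgP/eqP; apply: gammaG; exact: gammaR. Qed.
End NilpotentClass.

Section ClassFour.
Variable G : groupType.
Hypothesis gammaG : forall x, gamma_rec G 4 x -> x = 1.

Let central x z : gamma_rec G 3 x -> x ^ z = x.
Proof. by move=> /(gamma_last_commute gammaG)/commgP/conjg_fixP. Qed.

(** Here and in the next lemmas gamma_5 is trivial and g lies in gamma_3, so [g, z] lies in the
    central subgroup gamma_4 and the conjugations in the commutator identities disappear: the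
    commutator is multiplicative in each variable. *)
Lemma gamma3_commgVl g z : gamma_rec G 2 g -> [~ g^-1, z] = [~ g, z]^-1.
Proof.
move=> Gg; rewrite -[g^-1]mul1g commg_divl comm1g mul1g central //.
by apply: gammaV; exact: gammaR.
Qed.

Lemma gamma3_commgMl g h z :
  gamma_rec G 2 g -> gamma_rec G 2 h -> [~ g * h, z] = [~ g, z] * [~ h, z].
Proof.
move=> Gg Gh; rewrite -{1}[h]invgK commg_divl gamma3_commgVl // invgK.
rewrite central //.
by apply: gammaM; exact: gammaR.
Qed.

Lemma gamma3_commgVr g z : gamma_rec G 2 g -> [~ g, z^-1] = [~ g, z]^-1.
Proof.
move=> Gg; rewrite -[z^-1]mul1g commg_divr commg1 mulg1 central //.
by apply: gammaV; exact: gammaR.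
Qed.

Lemma gamma3_commgMr g z z' :
  gamma_rec G 2 g -> [~ g, z * z'] = [~ g, z] * [~ g, z'].
Proof.
move=> Gg; rewrite -{1}[z']invgK commg_divr gamma3_commgVr // invgK central.
  by apply: (gamma_last_commute gammaG); exact: gammaR.
by apply: gammaM; exact: gammaR.
Qed.

(** For fixed g the map z -> [g, z] is a homomorphism with central values, so it kills every
    commutator, hence gamma_2. *)
Lemma gamma3_gamma2_commute g h :
  gamma_rec G 2 g -> gamma_rec G 1 h -> commute g h.
Proof.
move=> Gg Gh; apply/commgP/eqP; move: h Gh.
apply: gammaS_min => [|x z _].
  split=> [|v w gv gw]; first exact: commg1.
  by rewrite /mkset gamma3_commgMr // gamma3_commgVr // gv gw divgg.
rewrite (_ : [~ x, z] = x^-1 * (z^-1 * (x * z))) //.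
rewrite !gamma3_commgMr // !gamma3_commgVr //.
set p := [~ g, x]; set q := [~ g, z].
rewrite (_ : p * q = q * p) ?mulKg ?mulVg //.
by apply: (gamma_last_commute gammaG); exact: gammaR.
Qed.

(* Hall-Witt for [a, y], a, y, where the factor [a, y^-1, [a, y]] is trivial. *)
Lemma commg_swap (a y : G) :
  [~ [~ a, y], a, y] = [~ [~ a, y], y, a].
Proof.
set u := [~ a, y]; set s := [~ u, a]; set t := [~ u, y].
have Gu : gamma_rec G 1 u by exact: (@gammaR G 0).
have Gs : gamma_rec G 2 s by exact: gammaR.
have Gt : gamma_rec G 2 t by exact: gammaR.
have HallWitt :
    [~ u, a^-1, y] ^ a * [~ a, y^-1, u] ^ y * [~ y, u^-1, a] ^ u = 1.
  by rewrite /commg /conjg !gnorm.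
have comm1V (x z : G) : [~ x, z^-1] = [~ x, z]^-1 ^ z^-1.
  by rewrite -{1}[z^-1]mul1g commg_divr commg1 mulg1.
(* [u, a^-1] is s^-1 times an element of gamma_4, and that factor vanishes in the next
   commutator. *)
have E1 : [~ u, a^-1, y] = [~ s, y]^-1.
  rewrite comm1V -/s conjg_mulR gamma3_commgMl; [|exact: gammaV|]; last first.
    by apply: gammaS_sub; apply: gammaR; exact: gammaV.
  rewrite gamma3_commgVl // [X in _ * X](_ : _ = 1) ?mulg1 //.
  by apply: gammaG; do 2!apply: gammaR; exact: gammaV.
(* [a, y^-1] is u^-1 times an element of gamma_3, and both factors commute with u. *)
have E2 : [~ a, y^-1, u] = 1.
  rewrite comm1V -/u conjg_mulR; apply/eqP/commgP/commute_sym/commuteM.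
    exact: commuteV.
  apply/commute_sym/gamma3_gamma2_commute => //.
  by apply: gammaR; exact: gammaV.
have E3 : [~ y, u^-1] = t.
  rewrite comm1V -invgR invgK; apply/conjg_fixP/commgP/commuteV.
  exact: gamma3_gamma2_commute.
move: HallWitt; rewrite E1 E2 E3 conj1g mulg1 !central.
- by move/mulg1_eq; rewrite invgK.
- exact: gammaR.
- by apply: gammaV; exact: gammaR.
Qed.
End ClassFour.

(** * Unitriangular matrices *)

Section Unitriangular.
Variable R : comNzRingType.

(* The entries above the diagonal of a unitriangular 5 x 5 matrix, listed one
   superdiagonal after the other. *)
Definition unitri5 : Type :=
  ((R * R * R * R) * (R * R * R) * (R * R) * R)%type.

HB.instance Definition _ := Choice.on unitri5.

Section Operations.
Local Open Scope ring_scope.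

Definition ut_mul (x y : unitri5) : unitri5 :=
  let: ((x12, x23, x34, x45), (x13, x24, x35), (x14, x25), x15) := x in
  let: ((y12, y23, y34, y45), (y13, y24, y35), (y14, y25), y15) := y in
  ((x12 + y12, x23 + y23, x34 + y34, x45 + y45),
   (x13 + y13 + x12 * y23, x24 + y24 + x23 * y34, x35 + y35 + x34 * y45),
   (x14 + y14 + x12 * y24 + x13 * y34, x25 + y25 + x23 * y35 + x24 * y45),
   x15 + y15 + x12 * y25 + x13 * y35 + x14 * y45).

Definition ut_one : unitri5 := ((0, 0, 0, 0), (0, 0, 0), (0, 0), 0).

(** The entries come from the finite series 1 - N + N^2 - N^3 + N^4 for the inverse of 1 + N, with N
    strictly upper triangular. *)
Definition ut_inv (x : unitri5) : unitri5 :=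
  let: ((x12, x23, x34, x45), (x13, x24, x35), (x14, x25), x15) := x in
  ((- x12, - x23, - x34, - x45),
   (x12 * x23 - x13, x23 * x34 - x24, x34 * x45 - x35),
   (x12 * x24 + x13 * x34 - x12 * x23 * x34 - x14,
    x23 * x35 + x24 * x45 - x23 * x34 * x45 - x25),
   x12 * x25 + x13 * x35 + x14 * x45 - x12 * x23 * x35 - x12 * x24 * x45
     - x13 * x34 * x45 + x12 * x23 * x34 * x45 - x15).

Fact ut_mulA : associative ut_mul.
Proof.
move=> [[[[[[x12 x23] x34] x45] [[x13 x24] x35]] [x14 x25]] x15].
move=> [[[[[[y12 y23] y34] y45] [[y13 y24] y35]] [y14 y25]] y15].
move=> [[[[[[z12 z23] z34] z45] [[z13 z24] z35]] [z14 z25]] z15] /=.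
by do !(congr (_, _)); ring.
Qed.

Fact ut_1mul : left_id ut_one ut_mul.
Proof.
move=> [[[[[[x12 x23] x34] x45] [[x13 x24] x35]] [x14 x25]] x15] /=.
by do !(congr (_, _)); ring.
Qed.

Fact ut_mul1 : right_id ut_one ut_mul.
Proof.
move=> [[[[[[x12 x23] x34] x45] [[x13 x24] x35]] [x14 x25]] x15] /=.
by do !(congr (_, _)); ring.
Qed.

Fact ut_Vmul : left_inverse ut_one ut_inv ut_mul.
Proof.
move=> [[[[[[x12 x23] x34] x45] [[x13 x24] x35]] [x14 x25]] x15] /=.
by do !(congr (_, _)); ring.
Qed.

Fact ut_mulV : right_inverse ut_one ut_inv ut_mul.
Proof.
move=> [[[[[[x12 x23] x34] x45] [[x13 x24] x35]] [x14 x25]] x15] /=.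
by do !(congr (_, _)); ring.
Qed.
End Operations.

HB.instance Definition _ := isGroup.Build unitri5
  ut_mulA ut_1mul ut_mul1 ut_Vmul ut_mulV.

Definition ut_super (x12 x23 x34 x45 : R) : unitri5 :=
  ((x12, x23, x34, x45), (0, 0, 0), (0, 0), 0)%R.

Definition ut_corner (r : R) : unitri5 :=
  ((0, 0, 0, 0), (0, 0, 0), (0, 0), r)%R.

Definition ut_top (x : unitri5) : R := x.2.

Lemma ut_cornerD r r' : ut_corner (r + r')%R = ut_corner r * ut_corner r'.
Proof. by rewrite /ut_corner; do !(congr (_, _)); ring. Qed.

Fact ut_cornerM :
  {morph (ut_corner : Algebra.to_multiplicative R -> unitri5) : r r' / r * r'}.
Proof. exact: ut_cornerD. Qed.

(** The central filtration by the number of vanishing superdiagonals. Guarding each block by a bound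
    on [n] lets one statement serve all levels; [gamma_rec] of index [n] lies in level [n]. *)
Definition ut_level (n : nat) (x : unitri5) : Prop :=
  let: ((x12, x23, x34, x45), (x13, x24, x35), (x14, x25), x15) := x in
  [/\ (0 < n)%N -> [/\ x12 = 0, x23 = 0, x34 = 0 & x45 = 0]%R,
      (1 < n)%N -> [/\ x13 = 0, x24 = 0 & x35 = 0]%R,
      (2 < n)%N -> x14 = 0%R /\ x25 = 0%R &
      (3 < n)%N -> x15 = 0%R].

Fact ut_level_subgroup n : is_subgroup (ut_level n).
Proof.
split; first by do !split.
move=> [[[[[[x12 x23] x34] x45] [[x13 x24] x35]] [x14 x25]] x15].
move=> [[[[[[y12 y23] y34] y45] [[y13 y24] y35]] [y14 y25]] y15].
move=> [X1 X2 X3 X4] [Y1 Y2 Y3 Y4].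
have N0 m : (m.+1 < n)%N -> (m < n)%N by exact: ltnW.
split=> n0.
- by have [? ? ? ?] := X1 n0; have [? ? ? ?] := Y1 n0; subst; split; ring.
- have [? ? ? ?] := X1 (N0 _ n0); have [? ? ? ?] := Y1 (N0 _ n0).
  by have [? ? ?] := X2 n0; have [? ? ?] := Y2 n0; subst; split; ring.
- have [? ? ? ?] := X1 (N0 _ (N0 _ n0)); have [? ? ? ?] := Y1 (N0 _ (N0 _ n0)).
  have [? ? ?] := X2 (N0 _ n0); have [? ? ?] := Y2 (N0 _ n0).
  by have [? ?] := X3 n0; have [? ?] := Y3 n0; subst; split; ring.
- have [? ? ? ?] := X1 (N0 _ (N0 _ (N0 _ n0))).
  have [? ? ? ?] := Y1 (N0 _ (N0 _ (N0 _ n0))).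
  have [? ? ?] := X2 (N0 _ (N0 _ n0)); have [? ? ?] := Y2 (N0 _ (N0 _ n0)).
  have [? ?] := X3 (N0 _ n0); have [? ?] := Y3 (N0 _ n0).
  by have ? := X4 n0; have ? := Y4 n0; subst; ring.
Qed.

Fact ut_levelR n x y : ut_level n x -> ut_level n.+1 [~ x, y].
Proof.
move: x y => [[[[[[x12 x23] x34] x45] [[x13 x24] x35]] [x14 x25]] x15].
move=> [[[[[[y12 y23] y34] y45] [[y13 y24] y35]] [y14 y25]] y15].
move=> [X1 X2 X3 X4].
split=> n0.
- by split; ring.
- by have [? ? ? ?] := X1 n0; subst; split; ring.
- have [? ? ? ?] := X1 (ltnW n0).
  by have [? ? ?] := X2 n0; subst; split; ring.
- have [? ? ? ?] := X1 (ltnW (ltnW n0)); have [? ? ?] := X2 (ltnW n0).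
  by have [? ?] := X3 n0; subst; ring.
Qed.

Lemma gamma_unitri n x : gamma_rec unitri5 n x -> ut_level n x.
Proof.
elim: n x => [|n IHn] x.
  by move: x => [[[[[[x12 x23] x34] x45] [[x13 x24] x35]] [x14 x25]] x15].
move: x; apply: (gammaS_min (ut_level_subgroup n.+1)) => x z /IHn.
exact: ut_levelR.
Qed.

Lemma gamma_unitri4 x : gamma_rec unitri5 4 x -> x = 1.
Proof.
move/gamma_unitri.
move: x => [[[[[[x12 x23] x34] x45] [[x13 x24] x35]] [x14 x25]] x15].
by move=> [[]// -> -> -> -> []// -> -> -> []// -> -> ->].
Qed.

Lemma gamma_unitri3 x : gamma_rec unitri5 3 x -> x = ut_corner (ut_top x).
Proof.
move/gamma_unitri.
move: x => [[[[[[x12 x23] x34] x45] [[x13 x24] x35]] [x14 x25]] x15].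
by move=> [[]// -> -> -> -> []// -> -> -> []// -> -> _].
Qed.
End Unitriangular.

Lemma commute_int_pow (G : groupType) (x z : G) n :
  commute x z -> commute x (int_pow z n).
Proof.
by case: n => n xz; [exact: commuteX | apply: commuteV; exact: commuteX].
Qed.

Section CentralPowers.
Variables (G : groupType) (z1 z2 z3 : G).
Hypotheses (C2 : forall x, commute x z2) (C3 : forall x, commute x z3).

Definition pow3 (n : Zgrp * Zgrp * Zgrp) : G :=
  int_pow z1 n.1.1 * int_pow z2 n.1.2 * int_pow z3 n.2.

Fact pow3M : {morph pow3 : m n / m * n}.
Proof.
move=> [[m1 m2] m3] [[n1 n2] n3].
rewrite /pow3 [int_pow z1 _]int_powD [int_pow z2 _]int_powD.
rewrite [int_pow z3 _]int_powD.
have c2 m x := commute_int_pow m (C2 x).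
have c3 m x := commute_int_pow m (C3 x).
rewrite /= !mulgA -(mulgA _ (int_pow z3 m3) (int_pow z1 n1)) -c3 mulgA.
rewrite -(mulgA _ (int_pow z2 m2) (int_pow z1 n1)) -c2 mulgA.
by rewrite -(mulgA _ (int_pow z3 m3) (int_pow z2 n2)) -c3 mulgA.
Qed.
End CentralPowers.

Lemma hom_pow3 (G H : groupType) (f : {multiplicative G -> H}) z1 z2 z3 n :
  f (pow3 z1 z2 z3 n) = pow3 (f z1) (f z2) (f z3) n.
Proof. by rewrite /pow3 !homM !hom_int_pow. Qed.

Section TwoGenerators.
Variables (G : groupType) (a y : G).
Hypothesis ay : generated_by2 a y.
Local Notation u := [~ a, y].

Lemma gamma1_span (L : set G) : is_subgroup L -> L u ->
  (forall x, gamma_rec G 2 x -> L x) -> forall x, gamma_rec G 1 x -> L x.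
Proof.
move=> sL Lu L2.
pose S := [set x | x = a \/ x = y]%classic.
apply: (gamma_step (S := S) ay) => //.
  by move=> K sK SK _ x _; apply: ay => //; apply: SK; [left | right].
move=> x [->|->]; rewrite commgg; split=> //; try exact: sL.1.
by rewrite -invgR; exact: is_subgroupV.
Qed.

Lemma gamma2_span (L : set G) : is_subgroup L -> L [~ u, a] -> L [~ u, y] ->
  (forall x, gamma_rec G 3 x -> L x) -> forall x, gamma_rec G 2 x -> L x.
Proof.
move=> sL Ls Lt L3; apply: (gamma_step (S := [set u]%classic) ay) => //.
  by move=> K sK SK K2; apply: gamma1_span => //; exact: SK.
by move=> _ ->; split=> //; exact: (@gammaR _ 0).
Qed.

Lemma commg_swap_mod :
  gamma_rec G 4 ([~ u, y, a]^-1 * [~ u, a, y]).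
Proof.
apply: (@coset_eq _ (gamma G 5) _ _).1; rewrite !homR; apply/esym/commg_swap.
exact: (@gamma_quotient G 4).
Qed.

(** Commuting s and t with the two generators gives four elements; [s, y] is replaced by [t, a]
    modulo gamma_5. *)
Lemma gamma3_span (L : set G) : is_subgroup L ->
  L [~ u, a, a] -> L [~ u, y, a] -> L [~ u, y, y] ->
  (forall x, gamma_rec G 4 x -> L x) -> forall x, gamma_rec G 3 x -> L x.
Proof.
move=> sL L1 L2 L3 L4.
pose S := [set x | x = [~ u, a] \/ x = [~ u, y]]%classic.
apply: (gamma_step (S := S) ay) => //.
  by move=> K sK SK K3; apply: gamma2_span => //; apply: SK; [left | right].
have Gu : gamma_rec G 1 u by exact: (@gammaR _ 0).
move=> _ [->|->]; split=> //; try exact: gammaR.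
rewrite -[X in L X](mulVKg [~ u, y, a]).
apply: is_subgroupM => //; exact: (L4 _ commg_swap_mod).
Qed.

(** Modulo gamma_5 the three commutators are central, so their ordered products form the image of a
    homomorphism from Z^3. This image is a subgroup, and its preimage is one to which [gamma3_span]
    applies. *)
Lemma gamma3_coset x : gamma_rec G 3 x -> exists n, coset (gamma G 5) x =
  pow3 (coset _ [~ u, a, a]) (coset _ [~ u, y, a]) (coset _ [~ u, y, y]) n.
Proof.
have central v (z : quotient (gamma G 5)) : gamma_rec G 3 v ->
    commute z (coset (gamma G 5) v).
  move=> Gv; apply/commute_sym/(gamma_last_commute (@gamma_quotient G 4)).
  exact: gamma_hom.
have Gu : gamma_rec G 1 u by exact: (@gammaR _ 0).
have G3 v w : gamma_rec G 3 [~ u, v, w] by do 2!apply: gammaR.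
pose f := hom_of (pow3M (coset _ [~ u, a, a])
  (fun z => central _ z (G3 y a)) (fun z => central _ z (G3 y y))).
suff: forall v, gamma_rec G 3 v ->
    [set f n | n in setT]%classic (coset (gamma G 5) v).
  by move=> H /H[n _ <-]; exists n.
have sf : is_subgroup [set f n | n in setT]%classic.
  by apply: image_subgroup; split.
apply: (gamma3_span (preimage_subgroup (coset (gamma G 5)) sf)).
- by exists (1%R, 0%R, 0%R); rewrite //= /pow3 /= !mulg1.
- by exists (0%R, 1%R, 0%R); rewrite //= /pow3 /= mulg1 mul1g.
- by exists (0%R, 0%R, 1%R); rewrite //= /pow3 /= !mul1g.
- move=> v Gv; exists 1; rewrite ?hom1 //.
  by apply/esym/coset_eq1.
Qed.
End TwoGenerators.

(** * The group of the knot modulo the fourth and fifth terms *)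

(** To be used with p = [a, y], q = [p, a] and r = [p, y], when the three arguments are a, a^y and
    its conjugate by y. *)
Lemma K4_word_central (G : groupType) (a p q r : G) :
  p * a = a * p * q -> (forall x, commute x q) -> (forall x, commute x r) ->
  K4_word a (a * p) (a * p * (p * r)) =
    q * q * (r * r)^-1 * (a * p * (a * p))^-1.
Proof.
move=> pa cq cr.
have cqV x : x * q^-1 = q^-1 * x by exact: commuteV.
have crV x : x * r^-1 = r^-1 * x by exact: commuteV.
have apE : a^-1 * p = q * p * a^-1.
  apply: (mulgI a); apply: (mulIg a).
  by rewrite !mulgA mulgV mul1g mulgVK pa cq !mulgA cq.
have apVE : a^-1 * p^-1 = q^-1 * p^-1 * a^-1.
  by rewrite -mulgA -!invgM pa.
pose d := (a * p * p)^-1.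
have cE : (a * p * (p * r))^-1 = r^-1 * d by rewrite /d -invgM !mulgA.
have -> : K4_word a (a * p) (a * p * (p * r)) =
    r^-1 * r^-1 * (d * (a * p) * d * a^-1 * (a * p) * a^-1).
  rewrite /K4_word cE !mulgA (crV (r^-1 * d * a * p)).
  by rewrite !mulgA.
have -> : d * (a * p) * d * a^-1 * (a * p) * a^-1 =
    p^-1 * p^-1 * p^-1 * (a^-1 * p) * a^-1 by rewrite /d !gnorm.
have -> : (a * p * (a * p))^-1 = p^-1 * (a^-1 * p^-1) * a^-1.
  by rewrite !invgM !mulgA.
rewrite apE apVE invgM -!mulgA.
rewrite (mulgA p^-1 q) cq !mulgA mulgVK; congr (_ * _ * _).
rewrite cq (cqV (q * q * r^-1 * r^-1 * p^-1)).
by rewrite -!mulgA mulKg.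
Qed.

Section WordClassThree.
Variables (G : groupType) (a y : G).
Local Notation u := [~ a, y].
Local Notation s := [~ a, y, a].
Local Notation t := [~ a, y, y].
Local Notation b := (a ^ y).

Lemma K4_word_class3 : (forall x, commute x s) -> (forall x, commute x t) ->
  K4_word a b (b ^ y) = s * s * (t * t)^-1 * (b * b)^-1.
Proof.
move=> cs ct; have bE : b = a * u := conjg_mulR a y.
have -> : b ^ y = a * u * (u * t) by rewrite {1}bE conjMg (conjg_mulR u y) bE.
rewrite bE; apply: K4_word_central => //; exact: commgC.
Qed.

(** The word becomes a product of central elements and b^-2, which b centralizes. So the defining
    relation is automatic in class three, and the knot group maps onto F_2 / gamma_4. *)
Lemma K4_rel_class3 : (forall x, commute x s) -> (forall x, commute x t) ->
  K4_rel a b (b ^ y).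
Proof.
move=> cs ct; apply/K4_relP; rewrite K4_word_class3 //.
have cb x : commute b x -> commute b x^-1 by exact: commuteV.
by do ![exact: cs | exact: ct | exact: commute_refl | apply: cb
       | apply: commuteM].
Qed.
End WordClassThree.

(* Modulo gamma_4 the word is s^2 t^-2 b^-2; since b commutes with it, and the
   commutator with [a, y] vanishes modulo gamma_5, so does [t^2 s^-2, a]. *)
Lemma K4_rel_class4 (G : groupType) (a y : G) :
  (forall x, gamma_rec G 4 x -> x = 1) -> K4_rel a (a ^ y) ((a ^ y) ^ y) ->
  [~ a, y, a, a] * [~ a, y, a, a] = [~ a, y, y, a] * [~ a, y, y, a].
Proof.
move=> G4 /K4_relP bw.
set u := [~ a, y]; set s := [~ u, a]; set t := [~ u, y].
set b := a ^ y in bw *; set w := K4_word _ _ _ in bw.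
have Gu : gamma_rec G 1 u by exact: (@gammaR G 0).
have Gs : gamma_rec G 2 s by exact: gammaR.
have Gt : gamma_rec G 2 t by exact: gammaR.
pose g := s * s * (t * t)^-1.
have Gg : gamma_rec G 2 g.
  by apply: gammaM; [|apply: gammaV]; exact: gammaM.
(* The class-three formula for w is valid in G / gamma_4; lifted to G it acquires a factor z in
   gamma_4, which is central. *)
have [z Gz wE] : exists2 z, gamma_rec G 3 z & g = w * (b * b) * z.
  pose N := gamma G 4; exists ((w * (b * b))^-1 * g); last by rewrite mulVKg.
  apply/(coset_eq N).
  have cG2 v (x : quotient N) : gamma_rec G 2 v -> commute x (coset N v).
    move=> Gv; apply/commute_sym/(gamma_last_commute (@gamma_quotient G 3)).
    exact: gamma_hom.
  rewrite homM hom_K4_word !homJ K4_word_class3; first 1 last.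
  - by move=> x; rewrite -!homR; exact: cG2.
  - by move=> x; rewrite -!homR; exact: cG2.
  rewrite /g /s /t /u /b !(homJ, homR, homM, homV).
  exact: mulgVK.
have bg : commute b g.
  rewrite wE; apply: commuteM; first by apply: (commuteM bw); exact: commuteM.
  by apply: commute_sym; exact: (gamma_last_commute G4).
have ga : [~ g, a] = 1.
  apply/eqP/commgP/commute_sym.
  (* g commutes with b by [bg], and with u because gamma_3 centralizes gamma_2 here. *)
  have ->: a = b * u^-1 by rewrite /b conjg_mulR mulgK.
  apply/commute_sym/commuteM; first exact: commute_sym.
  by apply: commuteV; exact: gamma3_gamma2_commute.
have Gtt : gamma_rec G 2 (t * t) by exact: gammaM.
have Gss : gamma_rec G 2 (s * s) by exact: gammaM.
move: ga; rewrite (gamma3_commgMl G4 _ Gss (gammaV Gtt)).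
rewrite (gamma3_commgVl G4 _ Gtt).
rewrite (gamma3_commgMl G4 _ Gs Gs) (gamma3_commgMl G4 _ Gt Gt).
exact: divg1_eq.
Qed.

Lemma GK4_generated : generated_by2 GK4_a GK4_y.
Proof. by move=> K sK Ka Ky; exact: GK4_gen_ind. Qed.

Lemma F2_generated : generated_by2 gen_p gen_q.
Proof. by move=> K sK Kp Kq; exact: F2_gen_ind. Qed.

Lemma quotient_hom_ext (G H : groupType) (N : normal_subgroup G)
    (f h : {multiplicative quotient N -> H}) :
  (forall x, f (coset N x) = h (coset N x)) -> f =1 h.
Proof. by move=> fh u; have [x ->] := coset_surj u. Qed.

Section GammaFourIsomorphism.
Let FQ := quotient (gamma F2 4).
Let GQ := quotient (gamma GK4 4).

Fact F2_quotient_rel (a y : FQ) : K4_rel a (a ^ y) ((a ^ y) ^ y).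
Proof.
by apply: K4_rel_class3 => x; apply: commute_sym;
  apply: (gamma_last_commute (@gamma_quotient F2 3)); do 2!apply: gammaR.
Qed.

Let to_FQ : {multiplicative GK4 -> FQ} :=
  GK4_lift (F2_quotient_rel (coset _ gen_p) (coset _ gen_q)).

Fact GQ_to_FQ_subproof x : normal_set (gamma GK4 4) x -> to_FQ x = 1.
Proof. by move=> Gx; apply: gamma_quotient; exact: gamma_hom. Qed.

Let GQ_to_FQ : {multiplicative GQ -> FQ} := quotient_lift GQ_to_FQ_subproof.

Let to_GQ : {multiplicative F2 -> GQ} :=
  comp_hom (coset (gamma GK4 4)) (F2_lift GK4_a GK4_y).

Fact FQ_to_GQ_subproof x : normal_set (gamma F2 4) x -> to_GQ x = 1.
Proof. by move=> Gx; apply: gamma_quotient; exact: gamma_hom. Qed.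

Let FQ_to_GQ : {multiplicative FQ -> GQ} := quotient_lift FQ_to_GQ_subproof.

Lemma GK4_F2_gamma4 : isomorphic GQ FQ.
Proof.
have toF z : GQ_to_FQ (coset _ z) = to_FQ z by exact: quotient_liftE.
have toG z : FQ_to_GQ (coset _ z) = coset _ (F2_lift GK4_a GK4_y z).
  exact: quotient_liftE.
have to_a : to_FQ GK4_a = coset _ gen_p by exact: GK4_lift_a.
have to_y : to_FQ GK4_y = coset _ gen_q by exact: GK4_lift_y.
apply: (@cancel_isomorphic _ _ GQ_to_FQ FQ_to_GQ).
  apply: (@quotient_hom_ext _ _ _ (comp_hom FQ_to_GQ GQ_to_FQ) (id_hom _)) => z.
  rewrite comp_homE toF; move: z.
  apply: (@GK4_hom_ext _ (comp_hom FQ_to_GQ to_FQ) (coset (gamma GK4 4))).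
    by rewrite comp_homE to_a toG F2_lift0.
  by rewrite comp_homE to_y toG F2_lift1.
apply: (@quotient_hom_ext _ _ _ (comp_hom GQ_to_FQ FQ_to_GQ) (id_hom _)) => z.
rewrite comp_homE toG toF; move: z.
apply: (@F2_hom_ext _ (comp_hom to_FQ (F2_lift GK4_a GK4_y))
  (coset (gamma F2 4))).
  by rewrite comp_homE F2_lift0.
by rewrite comp_homE F2_lift1.
Qed.
End GammaFourIsomorphism.

Lemma int_pow_corner (R : comNzRingType) (r : R) n :
  int_pow (ut_corner r) n = ut_corner (r *~ n)%R.
Proof.
have X m : ut_corner r ^+ m = ut_corner (r *+ m)%R.
  by elim: m => // m IHm; rewrite expgS IHm -ut_cornerD mulrS.
case: n => m /=; rewrite X // NegzE mulrNz.
exact/esym/(homV (hom_of (@ut_cornerM R)) (r *+ m.+1)%R).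
Qed.

(** * Detecting gamma_4 modulo gamma_5 by corner entries *)

Section Detection.
Variables (G : groupType) (R : comNzRingType).
Variable f : {multiplicative G -> unitri5 R}.

Lemma gamma3_corner x : gamma_rec G 3 x -> f x = ut_corner (ut_top (f x)).
Proof. by move=> Gx; apply: gamma_unitri3; exact: gamma_hom. Qed.

Lemma gamma3_topM x z : gamma_rec G 3 x -> gamma_rec G 3 z ->
  ut_top (f (x * z)) = (ut_top (f x) + ut_top (f z))%R.
Proof.
move=> Gx Gz; rewrite homM {1}(gamma3_corner Gx) {1}(gamma3_corner Gz).
by rewrite -ut_cornerD.
Qed.

Lemma gamma4_unitri x : gamma_rec G 4 x -> f x = 1.
Proof. by move=> Gx; apply: gamma_unitri4; exact: gamma_hom. Qed.

(** [f] kills gamma_5 and so factors through the quotient, where [x] is known by its exponents. The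
    corner entry thus becomes a linear form in the exponents. *)
Lemma gamma3_top x e1 e2 e3 n :
  gamma_rec G 3 e1 -> gamma_rec G 3 e2 -> gamma_rec G 3 e3 ->
  coset (gamma G 5) x = pow3 (coset _ e1) (coset _ e2) (coset _ e3) n ->
  ut_top (f x) = (ut_top (f e1) *~ n.1.1 + ut_top (f e2) *~ n.1.2
                  + ut_top (f e3) *~ n.2)%R.
Proof.
move=> G1 G2 G3; pose h := @quotient_lift _ (gamma G 5) _ f gamma4_unitri.
have hE z : h (coset _ z) = f z by exact: quotient_liftE.
rewrite -(hE x) => ->; rewrite /pow3 !homM !hom_int_pow !hE.
rewrite (gamma3_corner G1) (gamma3_corner G2) (gamma3_corner G3).
by rewrite !int_pow_corner -!ut_cornerD.
Qed.
End Detection.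

Definition comm1 (G : groupType) (a y : G) := [~ a, y, a, a].
Definition comm2 (G : groupType) (a y : G) := [~ a, y, y, a].
Definition comm3 (G : groupType) (a y : G) := [~ a, y, y, y].

Section BasicCommutators.
Variables (G : groupType) (a y : G).

Lemma gamma3_comm1 : gamma_rec G 3 (comm1 a y).
Proof. by do 3!apply: gammaR. Qed.

Lemma gamma3_comm2 : gamma_rec G 3 (comm2 a y).
Proof. by do 3!apply: gammaR. Qed.

Lemma gamma3_comm3 : gamma_rec G 3 (comm3 a y).
Proof. by do 3!apply: gammaR. Qed.

Variables (H : groupType) (f : {multiplicative G -> H}).

Lemma hom_comm1 : f (comm1 a y) = comm1 (f a) (f y).
Proof. by rewrite /comm1 !homR. Qed.

Lemma hom_comm2 : f (comm2 a y) = comm2 (f a) (f y).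
Proof. by rewrite /comm2 !homR. Qed.

Lemma hom_comm3 : f (comm3 a y) = comm3 (f a) (f y).
Proof. by rewrite /comm3 !homR. Qed.
End BasicCommutators.

(** The relator is twice the difference of [t, a] and [s, a] in additive notation. An integral form
    must therefore take equal values on both, as here and in the next lemma, whereas a form modulo 2
    may separate them, as in the third. *)
Lemma K4_rel_super_weighted : K4_rel (ut_super 1 1 1 0 : unitri5 int)
  (ut_super 1 1 1 0 ^ ut_super 0 0 (-1) 1)
  ((ut_super 1 1 1 0 ^ ut_super 0 0 (-1) 1) ^ ut_super 0 0 (-1) 1).
Proof. by vm_compute. Qed.

Lemma K4_rel_super_ayyy : K4_rel (ut_super 1 0 0 0 : unitri5 int)
  (ut_super 1 0 0 0 ^ ut_super 0 1 1 1)
  ((ut_super 1 0 0 0 ^ ut_super 0 1 1 1) ^ ut_super 0 1 1 1).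
Proof. by vm_compute. Qed.

Lemma K4_rel_super_yyaa : K4_rel (ut_super 0 0 1 1 : unitri5 'Z_2)
  (ut_super 0 0 1 1 ^ ut_super 1 1 0 0)
  ((ut_super 0 0 1 1 ^ ut_super 1 1 0 0) ^ ut_super 1 1 0 0).
Proof. by apply/eqP; vm_compute. Qed.

(* If a and y have superdiagonals (a_i) and (y_i), the corner entry of an
   element of gamma_4 is its leading Magnus form evaluated at
   (a_1 A* + y_1 Y* ) (x) ... (x) (a_4 A* + y_4 Y* ). The three forms below are
   AAAY - AAYY, AYYY and YYAA mod 2; they vanish on the relator and separate
   the classes of gamma_4 modulo gamma_5. *)
Definition detect1 : {multiplicative GK4 -> unitri5 int} :=
  GK4_lift K4_rel_super_weighted.
Definition detect2 : {multiplicative GK4 -> unitri5 int} :=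
  GK4_lift K4_rel_super_ayyy.
Definition detect3 : {multiplicative GK4 -> unitri5 'Z_2} :=
  GK4_lift K4_rel_super_yyaa.

Section GammaSection.
Local Notation e1 := (comm1 GK4_a GK4_y).
Local Notation e2 := (comm2 GK4_a GK4_y).
Local Notation e3 := (comm3 GK4_a GK4_y).
Local Notation N := (gamma GK4 5).

Lemma detect1E : [/\ ut_top (detect1 e1) = 1%R, ut_top (detect1 e2) = 1%R &
  ut_top (detect1 e3) = 0%R].
Proof.
rewrite hom_comm1 hom_comm2 hom_comm3 /detect1 !GK4_lift_a !GK4_lift_y.
by vm_compute.
Qed.

Lemma detect2E : [/\ ut_top (detect2 e1) = 0%R, ut_top (detect2 e2) = 0%R &
  ut_top (detect2 e3) = 1%R].
Proof.
rewrite hom_comm1 hom_comm2 hom_comm3 /detect2 !GK4_lift_a !GK4_lift_y.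
by vm_compute.
Qed.

Lemma detect3E : [/\ ut_top (detect3 e1) = 0%R, ut_top (detect3 e2) = 1%R &
  ut_top (detect3 e3) = 0%R].
Proof.
rewrite hom_comm1 hom_comm2 hom_comm3 /detect3 !GK4_lift_a !GK4_lift_y.
by split; apply/eqP; vm_compute.
Qed.

Lemma GK4_torsion : coset N e1 * coset N e1 = coset N e2 * coset N e2.
Proof.
rewrite hom_comm1 hom_comm2; apply: K4_rel_class4; first exact: gamma_quotient.
by have := hom_K4_rel (coset N) GK4_rel; rewrite !homJ.
Qed.

(** Defined on the whole group, but additive only on gamma_4, where the matrices reduce to their
    corner entries. *)
Definition detect (x : GK4) : Z2xZ_2 :=
  (ut_top (detect1 x), ut_top (detect2 x), ut_top (detect3 x)).

Lemma detectM x z : gamma_rec GK4 3 x -> gamma_rec GK4 3 z ->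
  detect (x * z) = detect x * detect z.
Proof. by move=> Gx Gz; rewrite /detect !gamma3_topM. Qed.

Lemma detect_pow3 x n :
  coset N x = pow3 (coset _ e1) (coset _ e2) (coset _ e3) n ->
  detect x = (n.1.1 + n.1.2, n.2, 1 *~ n.1.2)%R.
Proof.
move=> xn; have G1 := gamma3_comm1 GK4_a GK4_y.
have G2 := gamma3_comm2 GK4_a GK4_y; have G3 := gamma3_comm3 GK4_a GK4_y.
rewrite /detect !(gamma3_top _ G1 G2 G3 xn).
have [-> -> ->] := detect1E; have [-> -> ->] := detect2E.
have [-> -> ->] := detect3E.
by rewrite !mul0rz !intz addr0 !add0r addr0.
Qed.

Lemma Z_2_intr_eq0 (n : int) :
  (1 *~ n = 0 :> 'Z_2)%R -> exists k, n = (k + k)%R.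
Proof.
have Z2D (x : 'Z_2) : (x + x = 0)%R by apply/val_inj; case: x => -[|[|]].
have [k [->|->]] : exists k, n = (k + k)%R \/ n = (k + k + 1)%R.
  by exists (n %/ 2)%Z; lia.
  by exists k.
by rewrite !mulrzDr Z2D.
Qed.

Lemma int_powN (G : groupType) (x : G) n : int_pow x (- n) = (int_pow x n)^-1.
Proof. exact: (homV (int_power x)). Qed.

Lemma int_pow_double (G : groupType) (x : G) n :
  int_pow x (n + n) = int_pow (x * x) n.
Proof.
have X m : x ^+ (m + m) = (x * x) ^+ m.
  by rewrite expgnDr -expgMn //; exact: commute_refl.
case: n => m; first by rewrite /= -X.
by rewrite NegzE -opprD !int_powN -PoszD; congr (_^-1); exact: X.
Qed.

(** In terms of exponents the equations are n1 + n2 = 0, n3 = 0 and n2 even. So the class of x is a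
    power of the quotient of the squares of the first two commutators, which is trivial by
    [GK4_torsion]. *)
Lemma detect_eq1 x : gamma_rec GK4 3 x -> detect x = 1 -> gamma_rec GK4 4 x.
Proof.
move=> Gx; have [n xn] := gamma3_coset GK4_generated Gx.
rewrite (detect_pow3 xn) => -[n1 n3 /Z_2_intr_eq0[k n2]].
apply/(coset_eq1 N); rewrite xn /pow3 n3 mulg1.
have -> : n.1.1 = (- (k + k))%R by apply/eqP; rewrite -subr_eq0 opprK -n2 n1.
rewrite n2 int_powN !int_pow_double GK4_torsion.
exact: mulVg.
Qed.

Fact detect_gammaM :
  {morph (fun x : subgroup_group (gamma GK4 4) => detect (val x))
    : x z / x * z}.
Proof.
by move=> x z /=; rewrite -detectM //; exact: (subgroup_mem (K := gamma GK4 4)).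
Qed.

Lemma section_isomorphic :
  isomorphic (section_group (gamma GK4 4) (gamma GK4 5)) Z2xZ_2.
Proof.
pose D := hom_of detect_gammaM.
have DN x : normal_set (NormalSubgroup
    (normal_restrict (gamma GK4 4) (gamma GK4 5))) x -> D x = 1.
  move=> Gx; rewrite /D /= /detect !gamma4_unitri //.
have EE z : quotient_lift DN (coset _ z) = D z by exact: quotient_liftE.
apply: (inj_surj_isomorphic (f := quotient_lift DN)).
  move=> v; have [x ->] := coset_surj v; rewrite EE => Dx.
  apply/coset_eq1; apply: detect_eq1 => //.
  exact: (subgroup_mem (K := gamma GK4 4)).
move=> [[i k] m].
have Gp (e : GK4) n : gamma_rec GK4 3 e -> gamma_rec GK4 3 (int_pow e n).
  move=> Ge; have GX l : gamma_rec GK4 3 (e ^+ l).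
    elim: l => [|l IHl]; first exact: gamma1.
    by rewrite expgS; exact: gammaM.
  by case: n => l; [exact: GX | apply: gammaV; exact: GX].
(* Solves n1 + n2 = i, n3 = k and n2 = m modulo 2, with m lifted to its representative 0 or 1. *)
pose n : Zgrp * Zgrp * Zgrp := ((i - Posz m)%R, Posz m, k).
have Gx : gamma_rec GK4 3 (pow3 e1 e2 e3 n).
  apply: gammaM; first apply: gammaM; apply: Gp.
  - exact: gamma3_comm1.
  - exact: gamma3_comm2.
  - exact: gamma3_comm3.
exists (coset _ (subgroup_elt (K := gamma GK4 4) Gx)); rewrite EE /D /=.
rewrite (@detect_pow3 _ n) /=; last exact: (hom_pow3 (coset N)).
congr (_, _, _); first exact: subrK.
exact: natr_Zp.
Qed.
End GammaSection.

Definition F2_detect (s1 s2 s3 s4 t1 t2 t3 t4 : int) :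
    {multiplicative F2 -> unitri5 int} :=
  F2_lift (ut_super s1 s2 s3 s4) (ut_super t1 t2 t3 t4).

(** Integer corner entries vanish on x as soon as they vanish on its square, and they determine the
    three exponents of x. *)
Lemma F2_gamma3_torsion x :
  gamma_rec F2 3 x -> gamma_rec F2 4 (x * x) -> gamma_rec F2 4 x.
Proof.
move=> Gx Gxx; have [n xn] := gamma3_coset F2_generated Gx.
have top0 (f : {multiplicative F2 -> unitri5 int}) : ut_top (f x) = 0%R.
  have : ut_top (f (x * x)) = 0%R by rewrite gamma4_unitri.
  by rewrite gamma3_topM //; lia.
have G1 := gamma3_comm1 gen_p gen_q.
have G2 := gamma3_comm2 gen_p gen_q; have G3 := gamma3_comm3 gen_p gen_q.
have topE (f : {multiplicative F2 -> unitri5 int}) := gamma3_top f G1 G2 G3 xn.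
(* With A and Y dual to the two generators, the three representations used below have corner forms
   AAAY, YYAA and AYYY, a system dual to the three commutators. *)
have n1 : n.1.1 = 0%R.
  pose f := F2_detect 1 1 1 0 0 0 0 1.
  have [f1 f2 f3] : [/\ ut_top (f (comm1 gen_p gen_q)) = 1%R,
      ut_top (f (comm2 gen_p gen_q)) = 0%R &
      ut_top (f (comm3 gen_p gen_q)) = 0%R].
    rewrite hom_comm1 hom_comm2 hom_comm3 /f /F2_detect !F2_lift0 !F2_lift1.
    by vm_compute.
  by have := topE f; rewrite f1 f2 f3 top0 !mul0rz intz !addr0 => <-.
have n2 : n.1.2 = 0%R.
  pose f := F2_detect 0 0 1 1 1 1 0 0.
  have [f1 f2 f3] : [/\ ut_top (f (comm1 gen_p gen_q)) = 0%R,
      ut_top (f (comm2 gen_p gen_q)) = 1%R &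
      ut_top (f (comm3 gen_p gen_q)) = 0%R].
    rewrite hom_comm1 hom_comm2 hom_comm3 /f /F2_detect !F2_lift0 !F2_lift1.
    by vm_compute.
  by have := topE f; rewrite f1 f2 f3 top0 !mul0rz intz addr0 add0r => <-.
have n3 : n.2 = 0%R.
  pose f := F2_detect 1 0 0 0 0 1 1 1.
  have [f1 f2 f3] : [/\ ut_top (f (comm1 gen_p gen_q)) = 0%R,
      ut_top (f (comm2 gen_p gen_q)) = 0%R &
      ut_top (f (comm3 gen_p gen_q)) = 1%R].
    rewrite hom_comm1 hom_comm2 hom_comm3 /f /F2_detect !F2_lift0 !F2_lift1.
    by vm_compute.
  by have := topE f; rewrite f1 f2 f3 top0 !mul0rz intz !add0r => <-.
by apply/(coset_eq1 (gamma F2 5)); rewrite xn /pow3 n1 n2 n3 !mulg1.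
Qed.

(** The class T of [t, a][s, a]^-1 has order two and lies in gamma_4. Homomorphisms preserve the
    lower central series, so an isomorphism would carry T to a nontrivial element of order two in
    gamma_4(F_2) / gamma_5(F_2), which has none. *)
Lemma GK4_F2_gamma5 :
  ~ isomorphic (quotient (gamma GK4 5)) (quotient (gamma F2 5)).
Proof.
move=> [g /bij_inj gI].
pose e1 := comm1 GK4_a GK4_y; pose e2 := comm2 GK4_a GK4_y.
pose T := coset (gamma GK4 5) (e2 / e1).
have Ge1 : gamma_rec GK4 3 e1 by exact: gamma3_comm1.
have Ge2 : gamma_rec GK4 3 e2 by exact: gamma3_comm2.
have Ge : gamma_rec GK4 3 (e2 / e1) by apply: gammaM => //; exact: gammaV.
have TT : T * T = 1.
  have c12 : commute (coset _ e2 : quotient (gamma GK4 5)) (coset _ e1)^-1.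
    apply: commuteV; apply: (gamma_last_commute (@gamma_quotient GK4 4)).
    exact: (gamma_hom (coset (gamma GK4 5))).
  pose c := coset (gamma GK4 5) e1; pose d := coset (gamma GK4 5) e2.
  have dc : d * c^-1 = c^-1 * d := c12.
  have -> : T = d * c^-1 by rewrite /T homM homV.
  have E : c * c = d * d := GK4_torsion.
  by rewrite {1}dc -mulgA (mulgA d) -E mulgK mulVg.
have gT : gamma_rec (quotient (gamma F2 5)) 3 (g T).
  by do 2!apply: gamma_hom.
have cS v : exists x, coset (gamma F2 5) x = v.
  by have [x ->] := coset_surj v; exists x.
have [x Gx xT] := gamma_surj cS gT.
have /F2_gamma3_torsion : gamma_rec F2 4 (x * x).
  by apply/(coset_eq1 (gamma F2 5)); rewrite homM xT -homM TT hom1.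
move=> /(_ Gx)/(coset_eq1 (gamma F2 5)); rewrite xT -(hom1 g) => /gI.
move=> /(coset_eq1 (gamma GK4 5))/(gamma4_unitri detect3) T0.
(* If T were trivial, the two commutators would have the same corner entry modulo 2, but these
   entries are 1 and 0. *)
have := gamma3_topM detect3 Ge Ge1; rewrite mulgVK T0.
have [-> -> _] := detect3E; rewrite addr0 => /eqP.
by vm_compute.
Qed.

Theorem theorem4p7 :
  (exists j : forall k : int, {multiplicative B_ k -> A_ (k + 1)%R},
     [/\ forall k, injective (j k),
         forall k, respects_names (j k),
         forall k, isomorphic (B_ k) F2
       & exists phi : automorphism_action Zgrp (H4 j),
           isomorphic GK4 (semidirect phi)])
  /\
  [/\ isomorphic (quotient (gamma GK4 4)) (quotient (gamma F2 4)),
      isomorphic (section_group (gamma GK4 4) (gamma GK4 5)) Z2xZ_2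
    & ~ isomorphic (quotient (gamma GK4 5)) (quotient (gamma F2 5))].
Proof.
split; first exists B_right; split.
- exact: B_right_inj.
- exact: B_right_names.
- exact: B_isomorphic_F2.
- by exists (H4_action B_right_names); exact: GK4_semidirect.
- exact: GK4_F2_gamma4.
- exact: section_isomorphic.
- exact: GK4_F2_gamma5.
Qed.
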